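(* For every proper vertex-minor-closed graph class $\mathcal{G}$, there exists $k\in\mathbb{N}$ such that $\mathrm{igrid}(G)\le k$ for every $G\in\mathcal{G}$.
   Context: For a vertex $v$ of $G$, the local complementation $G*v$ is obtained by complementing the subgraph induced on the neighbourhood of $v$; $H$ is a vertex-minor of $G$ if $H$ is isomorphic to a graph obtained from $G$ by local complementations and vertex deletions. A class is proper if it does not contain all graphs, and vertex-minor-closed if closed under vertex-minors. $H$ is an induced minor of $G$ if a graph isomorphic to $H$ is obtained from $G$ by deleting vertices and contracting edges. The induced grid number $\mathrm{igrid}(G)$ is the largest integer $k$ such that $G$ contains the $(k\times k)$-grid (vertex set $[k]\times[k]$, two vertices adjacent iff they agree in one coordinate and differ by $1$ in the other) as an induced minor. *)

(* Defs.v *)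
From mathcomp Require Import all_boot.
From mathcomp Require Import boolp.

Set Implicit Arguments.
Unset Strict Implicit.
Unset Printing Implicit Defensive.

(* Finite simple graphs; the graph with no vertices is allowed. *)
Record graph := Graph {
  vertex :> finType;
  adj : rel vertex;
  adj_sym : symmetric adj;
  adj_irr : irreflexive adj }.

Definition isomorphic (G H : graph) : Prop :=
  exists2 f : G -> H, bijective f & forall x y, adj (f x) (f y) = adj x y.

Section Operations.
Variable G : graph.

Definition local_compl_rel (v : G) : rel G :=
  fun x y => adj x y (+) [&& adj v x, adj v y & x != y].

Fact local_compl_sym v : symmetric (local_compl_rel v).
Proof.
by move=> x y; rewrite /local_compl_rel adj_sym eq_sym; congr addb; rewrite andbCA.
Qed.

Fact local_compl_irr v : irreflexive (local_compl_rel v).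
Proof. by move=> x; rewrite /local_compl_rel adj_irr eqxx !andbF. Qed.

Definition local_compl (v : G) : graph :=
  Graph (local_compl_sym v) (local_compl_irr v).

Definition delete_rel (v : G) : rel {x : G | x != v} :=
  fun x y => adj (val x) (val y).

Fact delete_sym v : symmetric (@delete_rel v).
Proof. by move=> x y; apply: adj_sym. Qed.

Fact delete_irr v : irreflexive (@delete_rel v).
Proof. by move=> x; apply: adj_irr. Qed.

Definition delete_vertex (v : G) : graph :=
  Graph (@delete_sym v) (@delete_irr v).

(* The pair u, v is merged into a single vertex, represented by u; parallel
   edges and the loop are discarded.  This is edge contraction when u and v are
   adjacent, which is required wherever the operation is used. *)
Definition contract_rel (u v : G) : rel {x : G | x != v} :=
  fun x y => (x != y) && [|| adj (val x) (val y),
                             (val x == u) && adj v (val y) |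
                             (val y == u) && adj v (val x)].

Fact contract_sym u v : symmetric (@contract_rel u v).
Proof.
move=> x y; rewrite /contract_rel eq_sym adj_sym; congr (_ && (_ || _)).
exact: orbC.
Qed.

Fact contract_irr u v : irreflexive (@contract_rel u v).
Proof. by move=> x; rewrite /contract_rel eqxx. Qed.

Definition contract (u v : G) : graph :=
  Graph (@contract_sym u v) (@contract_irr u v).

End Operations.

Inductive vm_obtained (G : graph) : graph -> Prop :=
| vm_start : vm_obtained G G
| vm_local_compl (K : graph) (v : K) : vm_obtained G K -> vm_obtained G (local_compl v)
| vm_delete (K : graph) (v : K) : vm_obtained G K -> vm_obtained G (delete_vertex v).

Definition vertex_minor (H G : graph) : Prop :=
  exists2 K, vm_obtained G K & isomorphic H K.

Inductive im_obtained (G : graph) : graph -> Prop :=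
| im_start : im_obtained G G
| im_delete (K : graph) (v : K) : im_obtained G K -> im_obtained G (delete_vertex v)
| im_contract (K : graph) (u v : K) :
    adj u v -> im_obtained G K -> im_obtained G (contract u v).

Definition induced_minor (H G : graph) : Prop :=
  exists2 K, im_obtained G K & isomorphic H K.

Definition proper_class (C : graph -> Prop) : Prop := ~ (forall G, C G).

Definition vertex_minor_closed (C : graph -> Prop) : Prop :=
  forall G H, C G -> vertex_minor H G -> C H.

Definition differ_by_one (i j : nat) : bool := (i == j.+1) || (j == i.+1).

Definition grid_rel (k : nat) : rel ('I_k * 'I_k) :=
  fun p q => ((p.1 == q.1) && differ_by_one p.2 q.2)
          || ((p.2 == q.2) && differ_by_one p.1 q.1).

Fact grid_sym k : symmetric (@grid_rel k).
Proof.
move=> p q; rewrite /grid_rel /differ_by_one (eq_sym p.1) (eq_sym p.2).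
by rewrite (orbC (p.2 == _ :> nat)) (orbC (p.1 == _ :> nat)).
Qed.

Fact grid_irr k : irreflexive (@grid_rel k).
Proof.
by move=> p; rewrite /grid_rel /differ_by_one !eqn_leq !ltnn !andbF.
Qed.

Definition grid (k : nat) : graph := Graph (@grid_sym k) (@grid_irr k).

(* The range of the maximum loses nothing: a k x k grid that is an induced
   minor of G satisfies k <= k * k <= #|G|; see igridP. *)
Definition igrid (G : graph) : nat :=
  \max_(k < #|G|.+1 | `[< induced_minor (grid k) G >]) k.

Lemma im_obtained_card G K : im_obtained G K -> #|K| <= #|G|.
Proof.
elim=> // {}K => [v | u v _] _ IH;
  by apply: leq_trans IH; rewrite /= card_sig max_card.
Qed.

Lemma induced_minor_grid_bound G k : induced_minor (grid k) G -> k <= #|G|.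
Proof.
case=> K /im_obtained_card leKG [f /bij_eq_card eqK _].
apply: leq_trans leKG; rewrite -eqK /= card_prod card_ord.
by case: k {f eqK} => // k; rewrite leq_pmulr.
Qed.

Lemma induced_minor_grid0 G : induced_minor (grid 0) G.
Proof.
suff [K GK K0]: exists2 K, im_obtained G K & #|K| = 0.
  have noK (x : K) : False by have := card0_eq K0 x; rewrite inE.
  have no0 (p : grid 0) : False by case: p => -[].
  exists K => //; exists (fun p => False_rect K (no0 p)).
    by exists (fun x => False_rect (grid 0) (noK x)) => [p|x]; [case: (no0 p)|case: (noK x)].
  by move=> p; case: (no0 p).
have: im_obtained G G by constructor.
move: {2}G => K; move: {2}#|K| (leqnn #|K|) => n.
elim: n K => [|n IH] K leKn GK.
  by exists K => //; apply/eqP; rewrite -leqn0.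
have [K0|] := posnP #|K|; first by exists K.
case/card_gt0P=> v _; apply: IH (im_delete v GK).
rewrite /= card_sig -ltnS; apply: leq_trans leKn.
by rewrite (cardD1 v K) inE ltnS subset_leq_card //; apply/subsetP=> x; rewrite !inE andbT.
Qed.

Lemma igridP G :
  induced_minor (grid (igrid G)) G
  /\ forall k, induced_minor (grid k) G -> k <= igrid G.
Proof.
split=> [|k Gk].
  have P0 : `[< induced_minor (grid (@ord0 #|G|)) G >].
    exact/asboolP/induced_minor_grid0.
  by rewrite /igrid (bigmax_eq_arg _ P0); case: arg_maxnP => // i /asboolP.
have ltk : k < #|G|.+1 by rewrite ltnS induced_minor_grid_bound.
by apply: (bigmax_sup (Ordinal ltk)) => //; apply/asboolP.
Qed.

(* Main.v *)
(* Let H be a graph outside the class; we show that a graph G with a large grid as an induced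
   minor has H as a vertex-minor. Every graph on {0, ..., n-1} arises from the edgeless one by
   toggling edges between consecutive vertices and by local complementations, since the
   commutator of these operations toggles an arbitrary edge. Such a sequence is executed along
   n rows of the grid, the wires, from left to right. A head vertex is kept for each wire: the
   heads carry the graph built so far, and each is attached to the remaining part of its wire
   only. Shortest paths in the connected branch sets are induced, hence can be contracted into
   the heads by local complementations and deletions. A toggle is obtained by making two
   consecutive heads absorb a tripod each, with one foot on the wire and the other on a
   vertical connection between the two wires. *)

(* The obstacle is that branch sets are arbitrary connected sets and that neighbouring ones may be
   joined by any nonempty set of edges. Absorbing a path therefore attaches a head to an unknown
   nonempty part of the next branch set, and the invariant of a run fixes only in which cell these
   neighbours lie and that there is one. For the same reason the arms of a tripod need not meet in
   one vertex: the last vertex of the side path may see several vertices of the main path, and this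
   contact has to be normalised before the arms can be absorbed. A local complementation at a head
   would also join the other heads to its wire. The first vertex of a path along the wire then takes
   over as head: it inherits the neighbours of the old head, which is deleted. *)
Require Import Defs.
From mathcomp Require Import all_boot.
From mathcomp Require Import boolp zify.

Set Implicit Arguments.
Unset Strict Implicit.
Unset Printing Implicit Defensive.

(** * Local complementations and deletions *)

(* lia, preceded by the removal of the non-arithmetical hypotheses, on which zify is slow. *)
Ltac nat_test b :=
  lazymatch b with
  | leq _ _ => idtac
  | dvdn _ _ => idtac
  | true => idtac
  | false => idtac
  | negb ?a => nat_test a
  | andb ?a ?c => nat_test a; nat_test c
  | orb ?a ?c => nat_test a; nat_test c
  | addb ?a ?c => nat_test a; nat_test c
  | @eq_op ?T _ _ => unify (Equality.sort T) nat
  end.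

Ltac nat_fact P :=
  lazymatch P with
  | is_true ?b => nat_test b
  | ?b = true => nat_test b
  | ?b = false => nat_test b
  | ?x = _ :> ?T => unify T nat
  | ~ ?Q => nat_fact Q
  | ?Q /\ ?Q' => nat_fact Q; nat_fact Q'
  | ?Q \/ ?Q' => nat_fact Q; nat_fact Q'
  end.

Ltac arith :=
  solve [intros;
    repeat match goal with
    | H : ?P |- _ => lazymatch type of P with Prop => tryif nat_fact P then fail else clear H end
    end; lia].

Section VertexMinorSteps.
Variable V : finType.
Implicit Types (e : rel V) (S : {set V}) (s : seq V).

Definition lc e v : rel V :=
  fun x y => e x y (+) [&& e v x, e v y & x != y].

Definition lcs e s : rel V := foldl lc e s.

(** Graphs stay relations on the fixed type [V], and deletion only shrinks the set on which the
    relation is read. Postponing deletions is sound because the effect of a local complementation on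
    a pair does not depend on any other vertices than the pair and the centre. *)
Definition reduces e S e' S' :=
  S' \subset S /\ exists2 s, all (mem S) s & {in S' &, lcs e s =2 e'}.

Lemma lcs_restrict e e' S s : all (mem S) s -> {in S &, e =2 e'} ->
  {in S &, lcs e s =2 lcs e' s}.
Proof.
elim: s e e' => [|v s IH] e e' //= /andP[vS sS] ee'.
apply: IH => // x y xS yS.
by rewrite /lc !ee'.
Qed.

Lemma reduces_trans e1 S1 e2 S2 e3 S3 :
  reduces e1 S1 e2 S2 -> reduces e2 S2 e3 S3 -> reduces e1 S1 e3 S3.
Proof.
case=> S21 [s1 s1S E1] [S32 [s2 s2S E2]].
split; first exact: subset_trans S32 S21.
exists (s1 ++ s2).
  by rewrite all_cat s1S; apply/allP=> x /(allP s2S)/(subsetP S21).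
move=> x y xS yS; rewrite /lcs foldl_cat -E2 //.
by apply: (lcs_restrict s2S E1); apply: (subsetP S32).
Qed.

Lemma reduces_sub e S e' S' : S' \subset S -> {in S' &, e =2 e'} ->
  reduces e S e' S'.
Proof. by move=> S'S ee'; split=> //; exists [::]. Qed.

Lemma reduces_weaken e S e1 S1 e2 S2 : reduces e S e1 S1 ->
  S2 \subset S1 -> {in S2 &, e1 =2 e2} -> reduces e S e2 S2.
Proof. by move=> r1 S21 e12; apply: reduces_trans r1 _; apply: reduces_sub. Qed.

Lemma reduces_lc e S v e' S' : v \in S -> S' \subset S ->
  {in S' &, lc e v =2 e'} -> reduces e S e' S'.
Proof. by move=> vS S'S ee'; split=> //; exists [:: v]; rewrite //= vS. Qed.

(** For [x = y = h] the two toggles cancel, so no loop arises even if [N] contains [h]. *)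
Definition join (h : V) (N : pred V) e : rel V :=
  fun x y => e x y (+) ((x == h) && N y) (+) ((y == h) && N x).

Lemma join_sym h N e : symmetric e -> symmetric (join h N e).
Proof. by move=> sym_e x y; rewrite /join sym_e addbAC. Qed.

Lemma join_irr h (N : pred V) e : irreflexive e -> irreflexive (join h N e).
Proof. by move=> irr_e x; rewrite /join irr_e addFb addbb. Qed.

Lemma lc_sym e v : symmetric e -> symmetric (lc e v).
Proof.
by move=> sym_e x y; rewrite /lc sym_e eq_sym; congr addb; rewrite andbCA.
Qed.

Lemma lc_irr e v : irreflexive e -> irreflexive (lc e v).
Proof. by move=> irr_e x; rewrite /lc irr_e eqxx !andbF. Qed.

Definition segment (f : nat -> V) i m : {set V} := [set x in [seq f j | j <- iota i m]].

Lemma segmentP (f : nat -> V) i m x :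
  reflect (exists2 j, i <= j < i + m & x = f j) (x \in segment f i m).
Proof.
rewrite inE; apply: (iffP mapP) => -[j]; rewrite ?mem_iota => ij ->;
by exists j; rewrite ?mem_iota.
Qed.

Lemma mem_segment (f : nat -> V) i m j : i <= j < i + m -> f j \in segment f i m.
Proof. by move=> ij; apply/segmentP; exists j. Qed.

(* This is the pivot on the edge uv, the sequence of local complementations at u, v and u. *)
Lemma reduces_pivot e S h u v : symmetric e -> irreflexive e ->
  h \in S -> u \in S -> v \in S -> h != u -> h != v -> u != v ->
  {in S, forall z, e u z = (z == h) || (z == v)} -> ~~ e h v ->
  reduces e S (join h (e v) e) (S :\: [set u; v]).
Proof.
move=> sym_e irr_e hS uS vS hu hv uv eu hv'; split; first exact: subsetDl.
exists [:: u; v; u]; first by rewrite /= uS vS.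
move=> x y; rewrite !inE !negb_or.
move=> /andP[/andP[xu xv] xS] /andP[/andP[yu yv] yS].
have evu : e v u by rewrite sym_e eu // eqxx orbT.
have evh : e v h = false by rewrite sym_e; apply: negbTE.
rewrite /= /join /lc !(eu x, eu y, eu u, eu v) // !(irr_e, evu) !eqxx.
rewrite !(negbTE xv, negbTE yv, negbTE xu, negbTE yu, negbTE uv, eq_sym u x, eq_sym v x,
  eq_sym u y, eq_sym v y, eq_sym v u, eq_sym u h, eq_sym v h, negbTE hu, negbTE hv) /= ?evh.
have E1 : (v == h) = false by rewrite eq_sym (negbTE hv).
have E2 : (u == h) = false by rewrite eq_sym (negbTE hu).
rewrite ?E1 ?E2 /=.
by case: (eqVneq x h) => [->|xh]; case: (eqVneq y h) => [->|yh];
  rewrite ?eqxx ?evh ?irr_e ?(negbTE xh) 1?[h == y]eq_sym ?(negbTE yh) //=;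
  case: (e v x); case: (e v y); case: (x == y); case: (e _ _).
Qed.

(** Complementing at a vertex of degree two toggles the single pair formed by its neighbours. *)
Lemma reduces_suppress e S a b u : symmetric e -> irreflexive e ->
  u \in S -> a != b -> {in S, forall z, e u z = (z == a) || (z == b)} ->
  reduces e S (join a (pred1 b) e) (S :\ u).
Proof.
move=> sym_e irr_e uS ab eu; apply: (reduces_lc (v := u)) => //; first exact: subsetDl.
move=> x y; rewrite !inE => /andP[xu xS] /andP[yu yS].
rewrite /join /lc !eu //=.
have ba : (b == a) = false by rewrite eq_sym (negbTE ab).
have [->|xa] := eqVneq x a; have [->|ya] := eqVneq y a;
  rewrite ?eqxx ?ba ?(negbTE ab) ?addbF ?andbF ?addbK //=.
- by rewrite andbT.
- by rewrite xa andbT.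
by have [->|] := eqVneq x b; have [->|] := eqVneq y b; rewrite ?eqxx ?addbF.
Qed.

Definition consecutive i j := (i == j.+1) || (j == i.+1).

Record leg e S x (f : nat -> V) m : Prop := Leg {
  leg_start : f 0 = x;
  leg_mem : forall i, i <= m -> f i \in S;
  leg_inj : forall i j, i <= m -> j <= m -> f i = f j -> i = j;
  leg_edge : forall i j, i <= m -> j <= m -> e (f i) (f j) = consecutive i j;
  leg_deg2 : forall i z, 0 < i < m -> z \in S -> e (f i) z ->
    z = f i.-1 \/ z = f i.+1 }.

(** Suppressing [f 1] shortens the path by one edge, and a path of length 2 is absorbed by the pivot
    on its last edge. Among the absorbed vertices only [f m] may have neighbours off the path, and
    [x] inherits them. *)
Lemma leg_reduces e S x f m : symmetric e -> irreflexive e ->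
  2 <= m -> leg e S x f m ->
  reduces e S (join x (e (f m)) e) (S :\: segment f 1 m).
Proof.
elim: m e S f => // -[|[|m]] // IH e S f sym_e irr_e _ [f0 fS f_inj f_edge f_deg].
  have -> : segment f 1 2 = [set f 1; f 2].
    by apply/setP=> z; rewrite !inE.
  have ne i j : i <= 2 -> j <= 2 -> i != j -> f i != f j.
    by move=> ? ? /eqP ij; apply/eqP => /f_inj ?; lia.
  rewrite -f0; apply: reduces_pivot; rewrite ?fS ?ne // ?f_edge //.
  move=> z zS; apply/idP/orP => [/f_deg[]// ->|[] /eqP->]; rewrite ?eqxx ?f_edge //; auto.
have ne i j : i <= m.+3 -> j <= m.+3 -> (f i == f j) = (i == j).
  by move=> im jm; apply/eqP/eqP => [/f_inj|->] //; apply.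
have := @reduces_suppress e S x (f 2) (f 1) sym_e irr_e (fS 1 isT).
case; first by rewrite -f0 ne.
  move=> z zS; apply/idP/orP => [/f_deg[]// ->|[] /eqP->]; rewrite ?eqxx -?f0 ?f_edge //; auto.
set e1 := join _ _ _ => sub1 red1.
have {}red1 : reduces e S e1 (S :\ f 1) by split.
apply: reduces_trans red1 _.
(* The path skips [f 1], whose suppression has made [x] adjacent to [f 2]. *)
pose g i := if i == 0 then x else f i.+1.
have legg : leg e1 (S :\ f 1) x g m.+2.
  have gE i : i <= m.+2 -> e1 (g i) =1 fun z => e (g i) z (+)
      ((i == 0) && (z == f 2)) (+) ((i == 1) && (z == x)).
    move=> im z; rewrite /e1 /join /=; congr (_ (+) _ (+) _).
      by congr (_ && _); rewrite /g; case: i im => [|i] im; rewrite /= ?eqxx // -f0 ne.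
    by rewrite andbC; congr (_ && _); rewrite /g; case: i im => [|i] im; rewrite /= -?f0 ne.
  split=> //.
  + move=> i im; rewrite !inE /g; case: i im => [|i] im; rewrite -?f0 ne ?fS //; arith.
  + by move=> i j im jm; rewrite /g -f0; case: i im => [|i] im; case: j jm => [|j] jm //= /f_inj; lia.
  + move=> i j im jm; rewrite gE // /g -f0.
    by case: i im => [|i] im; case: j jm => [|j] jm //=; rewrite ?ne ?f_edge //; rewrite /consecutive; arith.
  move=> i z im; rewrite !inE gE; last by arith.
  rewrite /g -f0; case: i im => // i im /andP[zf1 zS] /=; rewrite addbF.
  case: i im => [|i] im /=.
    have [->|z0] := eqVneq z (f 0); first by left.
    by rewrite addbF => /f_deg[] // zf; [rewrite zf eqxx in zf1|right].
  by rewrite addbF => /f_deg []; auto.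
have red2 := IH _ _ _ (join_sym _ _ sym_e) (join_irr _ _ irr_e) isT legg.
apply: (reduces_weaken red2).
  apply/subsetP=> z; rewrite !in_setD => /andP[zf zS].
  rewrite in_set1 zS andbT; apply/andP; split.
    apply: contra zf => /segmentP[j jm ->]; rewrite /g; case: j jm => // j jm.
    by apply: mem_segment; arith.
  by apply: contra zf => /eqP->; apply: mem_segment; arith.
move=> y z; rewrite !in_setD => /andP[yf yS] /andP[zf zS].
have nf2 w : w \notin segment f 1 m.+3 -> (w == f 2) = false.
  by move=> wf; apply/negbTE; apply: contra wf => /eqP ->; apply: mem_segment; arith.
have gx : (g m.+2 == x) = false by rewrite /g -f0 ne.
have gf2 : (g m.+2 == f 2) = false by rewrite /g ne.
by rewrite /join /= /e1 /join /= !(nf2 y, nf2 z) // gx gf2 !andbF !addbF.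
Qed.

End VertexMinorSteps.

(** * Induced paths *)

Section InducedPaths.
Variable V : finType.
Implicit Types (e : rel V) (S D : {set V}).

Definition within D e : rel V := [rel x y | [&& x \in D, y \in D & e x y]].

Lemma connect_within_sub e D D' x y : D \subset D' ->
  connect (within D e) x y -> connect (within D' e) x y.
Proof.
move=> DD'; apply: connect_sub => u v /and3P[uD vD euv]; apply: connect1.
by apply/and3P; rewrite (subsetP DD' _ uD) (subsetP DD' _ vD).
Qed.

Definition linked e D (A B : pred V) :=
  exists x y, [/\ x \in D, A x, B y & connect (within D e) x y].

Record induced_path e D (A B : pred V) m (f : nat -> V) : Prop := InducedPath {
  ip_mem : forall i, i <= m -> f i \in D;
  ip_inj : forall i j, i <= m -> j <= m -> f i = f j -> i = j;
  ip_edge : forall i j, i <= m -> j <= m -> e (f i) (f j) = consecutive i j;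
  ip_start : forall i, i <= m -> A (f i) = (i == 0);
  ip_end : forall i, i <= m -> B (f i) = (i == m) }.

(** In a shortest walk from [A] to [B], a chord, a repetition, or a visit to [A] or [B] other than
    at the proper end would allow a shortcut. *)
Lemma linked_induced_path e D A B : symmetric e -> irreflexive e ->
  linked e D A B -> exists m f, induced_path e D A B m f.
Proof.
move=> sym_e irr_e [x [y [xD Ax By /connectP[p xp yp]]]].
pose walk m f := [/\ forall i, i <= m -> f i \in D,
  forall i, i < m -> e (f i) (f i.+1), A (f 0) & B (f m)].
have ex : exists m, `[< exists f, walk m f >].
  exists (size p); apply/asboolP; exists (nth x (x :: p)).
  have pe i : i < size p -> [&& nth x (x :: p) i \in D, nth x p i \in D & e (nth x (x :: p) i) (nth x p i)].
    by move/pathP: xp => /(_ x) xp ip; apply: xp.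
  split=> //; last by rewrite -[nth _ _ _]/(nth x (x :: p) (size p)) -[size p]/((size (x :: p)).-1) nth_last /= -yp.
    by case=> // i /pe /and3P[].
  by move=> i /pe /and3P[].
case: (ex_minnP ex) => m /asboolP[f [fD fe fA fB]] min_m.
have {}min_m m' g : walk m' g -> m <= m' by move=> w; apply: min_m; apply/asboolP; exists g.
(* Cutting out the [d] vertices after [f i] would give a shorter walk. Chords, repetitions and early
   visits to [B] are all excluded in this way. *)
have shift_walk i d : i <= m -> i + d <= m -> (i + d < m -> e (f i) (f (i + d).+1)) ->
    (i + d = m -> B (f i)) -> d = 0.
  move=> im idm ed Bi.
  suff /min_m : walk (m - d) (fun k => if k <= i then f k else f (k + d)) by arith.
  split=> //.
  - by move=> k km; case: ifP => ki; apply: fD; arith.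
  - move=> k km; case: ifP => ki; case: ifP => ki'; try arith.
    + by apply: fe; arith.
    + by have -> : k = i by [arith]; rewrite addSn; apply: ed; arith.
    by rewrite addSn; apply: fe; arith.
  case: ifP => ki; last by rewrite subnK //; arith.
  by have -> : m - d = i by [arith]; apply: Bi; arith.
have edge i j : i < j -> j <= m -> e (f i) (f j) -> j = i.+1.
  move=> ij jm eij; suff : j - i.+1 = 0 by arith.
  apply: (@shift_walk i); try arith.
  by have -> : (i + (j - i.+1)).+1 = j by arith.
have start i : i <= m -> A (f i) -> i = 0.
  move=> im Ai; suff /min_m : walk (m - i) (fun k => f (k + i)) by arith.
  split=> //.
  - by move=> k km; apply: fD; arith.
  - by move=> k km; apply: fe; arith.
  by rewrite subnK.
have fin i : i <= m -> B (f i) -> i = m.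
  move=> im Bi; suff : m - i = 0 by arith.
  by apply: (@shift_walk i); rewrite ?subnKC //; try arith.
have inj i j : i < j -> j <= m -> f i <> f j.
  move=> ij jm fij; suff : j - i = 0 by arith.
  apply: (@shift_walk i); rewrite ?subnKC //; try arith.
    by rewrite fij; apply: fe.
  by rewrite fij => jE; rewrite jE.
exists m, f; split=> //.
- move=> i j im jm fij; case: (ltngtP i j) => // ij.
    by case: (inj _ _ ij jm).
  by case: (inj _ _ ij im).
- move=> i j im jm; rewrite /consecutive.
  case: (ltngtP i j) => [ij|ji|->]; last by rewrite irr_e orbb ltn_eqF.
    apply/idP/idP => [/(edge _ _ ij jm)|]; first by arith.
    by case/orP=> /eqP ?; subst; [arith|apply: fe].
  rewrite sym_e; apply/idP/idP => [/(edge _ _ ji im)|]; first by arith.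
  by case/orP=> /eqP ?; subst; [apply: fe|arith].
- by move=> i im; apply/idP/eqP => [/(start _ im)|->].
by move=> i im; apply/idP/eqP => [/(fin _ im)|->].
Qed.

End InducedPaths.

(** * Absorbing paths into a head, and moving a head *)

Section Absorption.
Variable V : finType.
Implicit Types (e : rel V) (S D : {set V}).

(** If only a shortest path of [D] from the neighbours of [h] to the boundary is kept, then [h]
    followed by this path is a leg. Its length is at least 2, since no neighbour of [h] in [D] is on
    the boundary. [N] consists of the outer neighbours of its last vertex. *)
Lemma absorb_path e S h D : symmetric e -> irreflexive e ->
  h \in S -> D \subset S -> h \notin D ->
  (forall x y, x \in D -> e h x -> y \in S -> y != h -> e x y -> y \in D) ->
  linked e D (e h) (fun x => [exists y in S :\: (h |: D), e x y]) ->
  exists N : pred V, [/\ reduces e S (join h N e) (S :\: D),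
    (forall y, N y -> [/\ y \in S, y \notin D, y != h & exists2 x, x \in D & e x y])
    & exists y, N y].
Proof.
move=> sym_e irr_e hS DS hD h_deep /(linked_induced_path sym_e irr_e)[m [f [fD f_inj f_edge f_start f_end]]].
have fmD := fD m (leqnn m).
pose N := [pred y in S :\: (h |: D) | e (f m) y].
have m_gt0 : 0 < m.
  case: m fD f_inj f_edge f_start f_end @N fmD => // fD _ _ fh fN _ _.
  have /exists_inP[y] : [exists y in S :\: (h |: D), e (f 0) y] by rewrite fN.
  rewrite !inE negb_or => /andP[/andP[yh yD] yS] ey.
  by have := h_deep (f 0) y (fD 0 (leqnn 0)) _ yS yh ey; rewrite fh // (negbTE yD) => /(_ isT).
exists N; split.
- pose g i := if i is j.+1 then f j else h.
  pose S' := (S :\: D) :|: segment f 0 m.+1.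
  have SS' : S' \subset S.
    rewrite subUset subsetDl; apply/subsetP=> x /segmentP[j jm ->].
    by apply/(subsetP DS)/fD; arith.
  have red0 : reduces e S e S' by apply: reduces_sub.
  have gD i : 0 < i <= m.+1 -> g i \in D by case: i => // i im; apply: fD; arith.
  have legg : leg e S' h g m.+1.
    split=> //.
    + case=> [|i] im; rewrite in_setU in_setD ?hD ?hS //.
      by apply/orP; right; apply: mem_segment; arith.
    + case=> [|i] [|j] im jm //=; last by move/f_inj; lia.
        by move=> hf; move: hD; rewrite hf fD //; arith.
      by move=> hf; move: hD; rewrite -hf fD //; arith.
    + case=> [|i] [|j] im jm; rewrite /= ?irr_e //.
      * by rewrite f_start //; rewrite /consecutive; arith.
      * by rewrite sym_e f_start //; rewrite /consecutive; arith.
      by rewrite f_edge //; rewrite /consecutive; arith.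
    case=> // i z im; rewrite in_setU in_setD => /orP[/andP[zD zS]|/segmentP[j jm ->]] /= fz; last first.
      have /andP[ilem jlem] : (i <= m) && (j <= m) by arith.
      by move: fz; rewrite f_edge // => /orP[]/eqP ij; [left|right]; rewrite ij.
    have [zh|zh] := eqVneq z h.
      by left; move: fz; rewrite zh sym_e f_start; [move/eqP->|arith].
    have : [exists y in S :\: (h |: D), e (f i) y].
      by apply/exists_inP; exists z => //; rewrite !inE negb_or zh zD.
    by rewrite f_end; arith.
  apply: reduces_trans red0 _; apply: (reduces_weaken (leg_reduces sym_e irr_e _ legg)) => //.
    apply/subsetP=> z; rewrite !in_setD in_setU in_setD => /andP[zD zS].
    rewrite zD zS /= andbT; apply: contra zD => /segmentP[j jm ->]; apply: gD; arith.
  move=> y z; rewrite !in_setD => /andP[yD yS] /andP[zD zS].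
  rewrite /join /= !inE !negb_or yD yS zD zS !andbT.
  have [->|yh] := eqVneq y h; have [->|zh] := eqVneq z h; rewrite /= ?andbT ?andbF ?addbF //.
  by rewrite addbK.
- move=> y /andP[]; rewrite !inE negb_or => /andP[/andP[yh yD] yS] ey.
  by split=> //; exists (f m).
have /exists_inP[y yN ey] : [exists y in S :\: (h |: D), e (f m) y] by rewrite f_end.
by exists y; rewrite /N /= yN.
Qed.

(** The first path vertex [f 0] has no neighbours outside [D] except [h], so complementing at [h]
    gives it exactly the other outer neighbours of [h]. Once [h] is deleted, [f 0] replaces it and
    absorbs the rest of the path, which the two depth hypotheses make long enough. *)
Lemma shift_head e S h D : symmetric e -> irreflexive e ->
  h \in S -> D \subset S -> h \notin D ->
  (forall x y, x \in D -> e h x -> y \in S -> y != h -> e x y -> y \in D) ->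
  (forall x y z, x \in D -> e h x -> y \in D -> e x y ->
     z \in S -> z != h -> e y z -> z \in D) ->
  linked e D (e h) (fun x => [exists y in S :\: (h |: D), e x y]) ->
  exists h' (N : pred V),
    [/\ reduces e S (join h' N (lc e h)) (h' |: S :\: (h |: D)),
        h' \in D, e h h',
        (forall y, N y -> [/\ y \in S, y \notin D, y != h & exists2 x, x \in D & e x y])
      & exists y, N y].
Proof.
move=> sym_e irr_e hS DS hD deep1 deep2.
case/(linked_induced_path sym_e irr_e)=> m [f [fD f_inj f_edge f_start f_end]].
have f0D := fD 0 (leq0n m).
have hf0 : e h (f 0) by rewrite f_start.
have fmD := fD m (leqnn m).
have /exists_inP[y0 y0N ey0] : [exists y in S :\: (h |: D), e (f m) y] by rewrite f_end.
have [y0S y0h y0D] : [/\ y0 \in S, y0 != h & y0 \notin D].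
  by move: y0N; rewrite !inE negb_or => /andP[/andP[-> ->] ->].
have m_gt1 : 1 < m.
  case: m fD f_inj f_edge f_start f_end fmD ey0 => [|[|m]] // fD _ f_edge f_start _ _ ey0.
    by move: (deep1 _ _ f0D hf0 y0S y0h ey0); rewrite (negbTE y0D).
  by move: (deep2 _ _ _ f0D hf0 (fD 1 isT) (f_edge 0 1 isT isT) y0S y0h ey0); rewrite (negbTE y0D).
pose N := [pred y in S :\: (h |: D) | e (f m) y].
have hfi i : 0 < i <= m -> e h (f i) = false by move=> im; rewrite f_start; arith.
exists (f 0), N; split=> //; last by exists y0; rewrite /N /= y0N.
- pose S' := (S :\: (h |: D)) :|: segment f 0 m.+1.
  have S'S : h |: S' \subset S.
    rewrite subUset sub1set hS subUset subsetDl; apply/subsetP=> x /segmentP[j jm ->].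
    by apply/(subsetP DS)/fD; arith.
  have red0 : reduces e S e (h |: S') by apply: reduces_sub.
  have red1 : reduces e (h |: S') (lc e h) S'.
    by apply: (reduces_lc (v := h)) => //; rewrite ?setU11 ?subsetUr.
  have lcf i z : 0 < i <= m -> lc e h (f i) z = e (f i) z.
    by move=> im; rewrite /lc hfi // addbF.
  have legg : leg (lc e h) S' (f 0) f m.
    split=> //.
    + by move=> i im; rewrite in_setU mem_segment ?orbT.
    + move=> [|i] j im jm; last by rewrite lcf // f_edge.
      case: j jm => [|j] jm; first by rewrite lc_irr.
      by rewrite lc_sym // lcf // f_edge // /consecutive orbC.
    move=> i z im; rewrite in_setU => /orP[|/segmentP[j jm ->]]; rewrite lcf; try arith; last first.
      have /andP[ilem jlem] : (i <= m) && (j <= m) by arith.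
      by rewrite f_edge // => /orP[]/eqP ij; [left|right]; rewrite ij.
    move=> zN eiz.
    have : [exists y in S :\: (h |: D), e (f i) y] by apply/exists_inP; exists z.
    by rewrite f_end; arith.
  apply: reduces_trans red0 _; apply: reduces_trans red1 _.
  apply: (reduces_weaken (leg_reduces (lc_sym _ sym_e) (lc_irr _ irr_e) _ legg)) => //.
    apply/subsetP=> z /setU1P zN; rewrite in_setD in_setU; case: zN => [->|zN].
      rewrite [_ \in segment f 0 _]mem_segment // orbT andbT; apply/segmentP=> -[j jm] /f_inj; lia.
    rewrite zN andbT; apply: contraTN zN => /segmentP[j jm ->].
    by rewrite !inE fD ?orbT //; arith.
  move=> y z; rewrite /join /= => /setU1P yN /setU1P zN.
  congr (_ (+) _ (+) _).
    have [yf|//] := eqVneq y (f 0); congr (_ && _).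
    have im : 0 < m <= m by arith.
    rewrite lcf //; case: zN => [->|-> //].
    by rewrite f_edge // !inE f0D !orbT /= /consecutive; arith.
  have [zf|//] := eqVneq z (f 0); congr (_ && _).
  have im : 0 < m <= m by arith.
  rewrite lcf //; case: yN => [->|-> //].
  by rewrite f_edge // !inE f0D !orbT /= /consecutive; arith.
move=> y /andP[]; rewrite !inE negb_or => /andP[/andP[yh yD] yS] ey.
by split=> //; exists (f m).
Qed.

End Absorption.

(** * Combs and tripods *)

Section Combs.
Variable V : finType.
Implicit Types (e : rel V) (S D : {set V}).

(* An induced path p and an induced path g whose last vertex is adjacent to the vertices
   p j with X j; further edges leave the comb only at p 0, p M and g 0. *)
Record comb e S (p : nat -> V) M (g : nat -> V) t (X : pred nat) : Prop := Comb {
  comb_p : forall i, i <= M -> p i \in S;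
  comb_g : forall i, i <= t -> g i \in S;
  comb_pE : forall i j, i <= M -> j <= M -> (p i == p j) = (i == j);
  comb_gE : forall i j, i <= t -> j <= t -> (g i == g j) = (i == j);
  comb_pg : forall i j, i <= M -> j <= t -> (p i == g j) = false;
  comb_pp : forall i j, i <= M -> j <= M -> e (p i) (p j) = consecutive i j;
  comb_gg : forall i j, i <= t -> j <= t -> e (g i) (g j) = consecutive i j;
  comb_gp : forall i j, i <= t -> j <= M -> e (g i) (p j) = (i == t) && X j;
  comb_p_out : forall i z, 0 < i < M -> z \in S -> e (p i) z ->
    z \in segment p 0 M.+1 :|: segment g 0 t.+1;
  comb_g_out : forall i z, 0 < i <= t -> z \in S -> e (g i) z ->
    z \in segment p 0 M.+1 :|: segment g 0 t.+1 }.

Definition comb_teeth (p : nat -> V) M g t := segment p 1 M :|: segment g 0 t.+1.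

(** Three legs are absorbed into [p 0] in turn: [p 1] to [p a], after which the head sees [p a.+1]
    and [g t]; then the rest of [p]; then [g] read backwards. The bounds on [a] and [t] give each
    leg length at least 2. *)
Lemma comb1_reduces e S p M g t a : symmetric e -> irreflexive e ->
  comb e S p M g t (pred1 a) -> 2 <= a -> a + 2 <= M -> 1 <= t ->
  reduces e S (join (p 0) (fun z => e (p M) z (+) e (g 0) z) e)
    (S :\: comb_teeth p M g t).
Proof.
move=> sym_e irr_e [pS gS pE gE pg epp egg egp p_out g_out] a2 aM t1.
set h := p 0.
have gp i j : i <= t -> j <= M -> (g i == p j) = false by move=> *; rewrite eq_sym pg.
have epg i j : i <= M -> j <= t -> e (p i) (g j) = (j == t) && (i == a).
  by move=> *; rewrite sym_e egp.
have leg1 : leg e S h p a.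
  split=> [//|i im|i j im jm /eqP|i j im jm|i z im zS ez].
  - by apply: pS; arith.
  - by rewrite pE; [move/eqP|arith|arith].
  - by apply: epp; arith.
  have iM : 0 < i < M by arith.
  have := p_out i z iM zS ez; rewrite in_setU => /orP[]/segmentP[j jm zj]; subst z.
    have jM : j <= M by arith.
    by move: ez; rewrite epp //; [case/orP=> /eqP ij; [left|right]; rewrite ij|arith].
  by move: ez; rewrite epg; arith.
have {leg1} := leg_reduces sym_e irr_e a2 leg1.
set e1 := join h _ e; set S1 := S :\: _ => red1; apply: reduces_trans red1 _.
have sym1 : symmetric e1 by apply: join_sym.
have irr1 : irreflexive e1 by apply: join_irr.
have e1p i z : 0 < i <= M -> e1 (p i) z = e (p i) z (+) ((z == h) && consecutive a i).
  move=> im; rewrite /e1 /join /= pE ?epp; try arith.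
have e1g k z : k <= t -> e1 (g k) z = e (g k) z (+) ((z == h) && (k == t)).
  move=> km; rewrite /e1 /join /= gp ?epg ?eqxx ?andbT ?addbF //; arith.
pose f i := if i == 0 then h else p (a + i).
have S1P z : z \in S1 -> z \in S /\ forall j, 0 < j <= a -> z != p j.
  rewrite in_setD => /andP[zp zS]; split=> // j ja; apply: contra zp => /eqP->.
  by apply: mem_segment; arith.
have S1p j : j <= M -> (j == 0) || (a < j) -> p j \in S1.
  move=> jM ja; rewrite in_setD pS // andbT; apply/segmentP=> -[i im /eqP].
  by rewrite pE; arith.
have S1g j : j <= t -> g j \in S1.
  move=> jt; rewrite in_setD gS // andbT; apply/segmentP=> -[i im /eqP].
  by rewrite gp; arith.
have f0 : f 0 = p 0 by [].
have fp i : 0 < i -> f i = p (a + i) by case: i.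
have leg2 : leg e1 S1 h f (M - a).
  split=> //.
  - by move=> [|i] im; [apply: S1p|rewrite fp // S1p //; arith].
  - by move=> [|i] [|j] im jm // /eqP; rewrite ?f0 ?fp // pE; arith.
  - move=> [|i] [|j] im jm; rewrite ?f0 ?irr1 ?fp //.
    + by rewrite sym1 e1p ?eqxx ?epp /consecutive; arith.
    + by rewrite e1p ?eqxx ?epp /consecutive; arith.
    by rewrite e1p ?pE ?epp /consecutive; arith.
  move=> i z im /S1P[zS zp]; rewrite fp ?e1p; try arith.
  have [->|zh] := eqVneq z h.
    rewrite epp /=; try arith. 
    rewrite /consecutive => ai; left.
    by have -> : i.-1 = 0 by arith.
  rewrite addbF => ez.
  have iM : 0 < a + i < M by arith.
  have := p_out _ z iM zS ez; rewrite in_setU => /orP[]/segmentP[j jm zj]; subst z.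
    have jM : j <= M by arith.
    have ja : a < j.
      rewrite ltnNge; apply/negP=> ja; have [j0|j0] := posnP j.
        by rewrite j0 eqxx in zh.
      by have := zp j; rewrite eqxx j0 ja => /(_ isT).
    move: ez; rewrite epp //; last by arith.
    by case/orP=> /eqP ij; [left|right]; rewrite fp; try arith; congr p; arith.
  by move: ez; rewrite epg; arith.
have M2 : 2 <= M - a by arith.
have fM : f (M - a) = p M by rewrite fp; [congr p|]; arith.
have {leg2} := leg_reduces sym1 irr1 M2 leg2; rewrite fM.
set e2 := join h _ e1; set S2 := S1 :\: _ => red2; apply: reduces_trans red2 _.
have sym2 : symmetric e2 by apply: join_sym.
have irr2 : irreflexive e2 by apply: join_irr.
have e2g k z : k <= t -> e2 (g k) z = e (g k) z (+) ((z == h) && (k == t)).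
  move=> kt; rewrite /e2 /join gp // [e1 (p M) (g k)]e1p; last by arith.
  rewrite epg // gp // e1g // /=.
  have -> : (M == a) = false by arith.
  by rewrite !andbF !addbF.
have S2P z : z \in S2 -> z \in S /\ forall j, 0 < j <= M -> z != p j.
  rewrite in_setD => /andP[zf /S1P[zS zp]]; split=> // j jM.
  have [ja|ja] := leqP j a; first by apply: zp; arith.
  apply: contra zf => /eqP->; apply/segmentP; exists (j - a); first by arith.
  by rewrite fp; [congr p|]; arith.
have S2g j : j <= t -> g j \in S2.
  move=> jt; rewrite in_setD S1g // andbT; apply/segmentP=> -[i im /eqP].
  by rewrite fp ?gp; arith.
have hS2 : h \in S2.
  rewrite in_setD S1p // andbT; apply/segmentP=> -[i im /eqP].
  by rewrite fp ?pE; arith.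
pose f' i := if i == 0 then h else g (t.+1 - i).
have f'0 : f' 0 = p 0 by [].
have fg i : 0 < i -> f' i = g (t.+1 - i) by case: i.
have leg3 : leg e2 S2 h f' t.+1.
  split=> //.
  - by move=> [|i] im //; rewrite fg // S2g //; arith.
  - by move=> [|i] [|j] im jm // /eqP; rewrite ?f'0 ?fg // ?gE ?gp ?pg; arith.
  - move=> [|i] [|j] im jm; rewrite ?f'0 ?irr2 ?fg //.
    + by rewrite sym2 e2g ?eqxx ?egp /=; try arith; rewrite /consecutive; arith.
    + by rewrite e2g ?eqxx ?egp /=; try arith; rewrite /consecutive; arith.
    by rewrite e2g ?gp ?egg /=; try arith; rewrite /consecutive; arith.
  move=> i z im /S2P[zS zp]; rewrite fg ?e2g; try arith.
  have [->|zh] := eqVneq z h.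
    rewrite egp /=; try arith.
    move=> ai; left.
    by have -> : i.-1 = 0 by arith.
  rewrite addbF => ez.
  have iM : 0 < t.+1 - i <= t by arith.
  have := g_out _ z iM zS ez; rewrite in_setU => /orP[]/segmentP[j jm zj]; subst z.
    have [j0|j0] := posnP j; first by rewrite j0 eqxx in zh.
    by have := zp j; rewrite eqxx j0 => /(_ jm).
  have jM : j <= t by arith.
  move: ez; rewrite egg //; last by arith.
  by case/orP=> /eqP ij; [right|left]; rewrite fg; try arith; congr g; arith.
have fT : f' t.+1 = g 0 by rewrite fg // subnn.
apply: (reduces_weaken (leg_reduces sym2 irr2 _ leg3)) => //.
  apply/subsetP=> z; rewrite in_setD in_setU negb_or => /andP[/andP[zp zg] zS].
  rewrite !in_setD zS andbT; apply/and3P; split.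
  - by apply: contra zg => /segmentP[j jm ->]; rewrite fg; [apply: mem_segment|]; arith.
  - by apply: contra zp => /segmentP[j jm ->]; rewrite fp; [apply: mem_segment|]; arith.
  by apply: contra zp => /segmentP[j jm ->]; apply: mem_segment; arith.
(* No remaining vertex sees [p a], so the first absorption leaves no trace on the final graph. *)
have paz z : z \in S :\: comb_teeth p M g t -> e (p a) z = false.
  rewrite in_setD in_setU negb_or => /andP[/andP[zp zg] zS].
  apply/negP => ez; have aM' : 0 < a < M by arith.
  have := p_out _ _ aM' zS ez; rewrite in_setU (negbTE zg) orbF => /segmentP[j jm zj]; subst z.
  have [j0|j0] := posnP j; first by move: ez; rewrite j0 epp /consecutive //; arith.
  by case/negP: zp; apply: mem_segment; arith.
move=> y z /paz yp /paz zp.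
by rewrite fT /join /= !e2g // /e2 /join !e1p /e1 /join ?yp ?zp; arith.
Qed.

(* Local complementation at p a turns X = {a, a+1} into X = {a-1}. *)
Lemma comb2_reduces e S p M g t a X : symmetric e -> irreflexive e ->
  comb e S p M g t X -> (forall j, j <= M -> X j = (j == a) || (j == a.+1)) ->
  3 <= a -> a.+3 <= M -> 1 <= t ->
  reduces e S (join (p 0) (fun z => e (p M) z (+) e (g 0) z) e)
    (S :\: comb_teeth p M g t).
Proof.
move=> sym_e irr_e [pS gS pE gE pg epp egg egp p_out g_out] Xa a3 aM t1.
have gp i j : i <= t -> j <= M -> (g i == p j) = false by move=> *; rewrite eq_sym pg.
have epg i j : i <= M -> j <= t -> e (p i) (g j) = (j == t) && ((i == a) || (i == a.+1)).
  by move=> iM jt; rewrite sym_e egp // Xa.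
have aleM : a <= M by arith.
have paz z : z \in S :\: comb_teeth p M g t -> e (p a) z = false.
  rewrite in_setD in_setU negb_or => /andP[/andP[zp zg] zS].
  apply/negP => ez; have aM' : 0 < a < M by arith.
  have := p_out _ _ aM' zS ez; rewrite in_setU (negbTE zg) orbF => /segmentP[j jm zj]; subst z.
  have [j0|j0] := posnP j; first by move: ez; rewrite j0 epp /consecutive //; arith.
  by case/negP: zp; apply: mem_segment; arith.
pose e1 := lc e (p a); pose S1 := S :\ p a.
have red1 : reduces e S e1 S1 by apply: (reduces_lc (v := p a)); rewrite ?pS // subsetDl.
have sym1 : symmetric e1 by apply: lc_sym.
have irr1 : irreflexive e1 by apply: lc_irr.
pose p' i := if i < a then p i else p i.+1.
pose s i := if i < a then i else i.+1.
have p's i : p' i = p (s i) by rewrite /p' /s; case: ifP.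
have sM i : i <= M.-1 -> s i <= M by rewrite /s; case: ifP; arith.
have teeth' z : z \in comb_teeth p' M.-1 g t -> z \in comb_teeth p M g t.
  rewrite !in_setU => /orP[/segmentP[j jm ->]|->]; last by rewrite orbT.
  by rewrite p's mem_segment //; have := @sM j; rewrite /s; case: ifP; arith.
have in_teeth' z : z \in S1 -> z \in segment p 0 M.+1 :|: segment g 0 t.+1 ->
    z \in segment p' 0 M.-1.+1 :|: segment g 0 t.+1.
  rewrite in_setD1 !in_setU => /andP[zp zS] /orP[/segmentP[j jm zj]|->]; last by rewrite orbT.
  subst z; move: zp; rewrite pE //; try arith; move=> ja.
  suff -> : p j = p' (if j < a then j else j.-1) by rewrite mem_segment //; case: ifP; arith.
  by rewrite p's /s; case: (ltnP j a) => ?; case: ifP => ?; congr p; arith.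
have comb' : comb e1 S1 p' M.-1 g t (pred1 a.-1).
  split.
  - move=> i im; rewrite in_setD1 p's pS ?sM // pE ?sM // andbT /s.
    by case: ifP; arith.
  - by move=> i im; rewrite in_setD1 gS // gp.
  - move=> i j im jm; rewrite !p's pE ?sM // /s.
    by case: ifP => ?; case: ifP => ?; arith.
  - by [].
  - by move=> i j im jm; rewrite p's pg ?sM.
  - move=> i j im jm; rewrite !p's /e1 /lc !epp ?sM // pE ?sM // /consecutive /s.
    by case: ifP => ?; case: ifP => ?; arith.
  - move=> i j im jm; rewrite /e1 /lc egg // !epg // gE //.
    by rewrite /consecutive; arith.
  - move=> i j im jm; rewrite p's /e1 /lc egp ?sM // epp ?sM // epg ?sM // gp ?sM // Xa ?sM //.
    by rewrite /consecutive /s /=; case: ifP => ?; arith.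
  - move=> i z im zS1 ez; apply: in_teeth' => //.
    have zS : z \in S by move: zS1; rewrite in_setD1 => /andP[].
    move: ez; rewrite p's /e1 /lc; case ez : (e (p (s i)) z) => /=.
      by move=> _; apply: p_out ez => //; move: im; rewrite /s; case: ifP; arith.
    by case/and3P=> _ ez' _; apply: p_out ez' => //; arith.
  move=> i z im zS1 ez; apply: in_teeth' => //.
  have zS : z \in S by move: zS1; rewrite in_setD1 => /andP[].
  move: ez; rewrite /e1 /lc; case ez : (e (g i) z) => /=.
    by move=> _; apply: g_out ez.
  by case/and3P=> _ ez' _; apply: p_out ez' => //; arith.
have a'2 : 2 <= a.-1 by arith.
have a'M : a.-1 + 2 <= M.-1 by arith.
apply: reduces_trans red1 _; apply: (reduces_weaken (comb1_reduces sym1 irr1 comb' a'2 a'M t1)).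
  apply/subsetP=> z; rewrite in_setD => /andP[zt zS].
  rewrite in_setD in_setD1 zS andbT; apply/andP; split.
    by apply: contra zt => /teeth'.
  apply: contra zt => /eqP->; rewrite in_setU mem_segment //; arith.
move=> y z /paz yp /paz zp.
have -> : p' 0 = p 0 by rewrite p's /s; case: ifP => // ?; arith.
have -> : p' M.-1 = p M by rewrite p's /s; case: ifP => // ?; congr p; arith.
by rewrite /join /e1 /lc yp zp !andbF !addbF.
Qed.

(* With the vertices strictly between p a and p b deleted, p is rerouted through g t. *)
Lemma comb_reroute e S p M g t a b X : symmetric e -> irreflexive e ->
  comb e S p M g t X -> X a -> X b -> (forall j, j <= M -> X j -> a <= j <= b) ->
  1 <= a -> a.+2 <= b -> b < M -> 2 <= t ->
  reduces e S (join (p 0) (fun z => e (p M) z (+) e (g 0) z) e)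
    (S :\: comb_teeth p M g t).
Proof.
move=> sym_e irr_e [pS gS pE gE pg epp egg egp p_out g_out] Xa Xb Xab a1 ab bM t2.
have gp i j : i <= t -> j <= M -> (g i == p j) = false by move=> *; rewrite eq_sym pg.
have epg i j : i <= M -> j <= t -> e (p i) (g j) = (j == t) && X i.
  by move=> iM jt; rewrite sym_e egp.
pose S1 := S :\: segment p a.+1 (b - a.+1).
have red1 : reduces e S e S1 by apply: reduces_sub; rewrite ?subsetDl.
pose s i := if i <= a then i else b + i - a.+2.
(* [g t] takes position [a.+1] and [p] resumes with [p b] at position [a.+2]. The side path now ends
   at [g t.-1], whose only contact is position [a.+1]. *)
pose p' i := if i == a.+1 then g t else p (s i).
pose M' := a.+2 + (M - b).
have sM i : i <= M' -> i != a.+1 -> s i <= M by rewrite /s /M'; case: ifP; arith.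
have s_out i : i <= M' -> i != a.+1 -> (s i <= a) || (b <= s i).
  by rewrite /s /M'; case: ifP; arith.
have Xs i : i <= M' -> i != a.+1 -> X (s i) = (i == a) || (i == a.+2).
  move=> iM ia; apply/idP/idP => [/(Xab _ (sM _ iM ia))|].
    by rewrite /s; case: ifP; arith.
  rewrite /s; case/orP=> /eqP->; first by rewrite leqnn.
  by have -> : (a.+2 <= a) = false by [arith]; rewrite addnK.
have teeth' z : z \in comb_teeth p' M' g t.-1 -> z \in comb_teeth p M g t.
  rewrite !in_setU => /orP[]/segmentP[j jm ->].
    rewrite /p'; case: eqP => [_|/eqP ja]; first by rewrite [_ \in segment g _ _]mem_segment ?orbT //; arith.
    rewrite mem_segment //; have := @sM j; move: ja; rewrite /s; case: ifP => ?; arith.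
  by rewrite [_ \in segment g _ _]mem_segment ?orbT //; arith.
have in_teeth' z : z \in S1 -> z \in segment p 0 M.+1 :|: segment g 0 t.+1 ->
    z \in segment p' 0 M'.+1 :|: segment g 0 t.-1.+1.
  rewrite in_setD !in_setU => /andP[zp zS] /orP[]/segmentP[j jm zj]; subst z.
    have jab : (j <= a) || (b <= j).
      by apply: contraR zp => jab; apply: mem_segment; arith.
    suff : exists2 i, i <= M' & (i != a.+1) && (s i == j).
      case=> i iM /andP[ia /eqP <-]; apply/orP; left; apply/segmentP; exists i; first by arith.
      by rewrite /p' (negbTE ia).
    case/orP: jab => jab; [exists j|exists (j - b + a.+2)]; rewrite /s /M'; try arith.
      by rewrite jab; arith.
    by case: ifP => ?; arith.
  have [->|jt] := eqVneq j t; last by rewrite [_ \in segment g _ _]mem_segment ?orbT //; arith.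
  apply/orP; left; apply/segmentP; exists a.+1; first by rewrite /M'; arith.
  by rewrite /p' eqxx.
have comb' : comb e S1 p' M' g t.-1 (pred1 a.+1).
  split.
  - move=> i im; rewrite in_setD /p'; case: eqP => [_|/eqP ia].
      rewrite gS // andbT; apply/segmentP=> -[j jm /eqP]; rewrite gp //; arith.
    rewrite pS ?sM // andbT; apply/segmentP=> -[j jm /eqP]; rewrite pE ?sM //; last by arith.
    by have := s_out _ im ia; arith.
  - move=> i im; rewrite in_setD gS ?andbT; last by arith.
    by apply/segmentP=> -[j jm /eqP]; rewrite gp //; arith.
  - move=> i j im jm; rewrite /p'; have [iE|ia] := eqVneq i a.+1; have [jE|ja] := eqVneq j a.+1; try subst i; try subst j.
    + by rewrite !eqxx.
    + by rewrite gp ?sM // eq_sym (negbTE ja).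
    + by rewrite pg ?sM // (negbTE ia).
    rewrite pE ?sM // /s; case: ifP => ?; case: ifP => ?; arith.
  - by move=> i j im jm; rewrite gE //; arith.
  - move=> i j im jm; rewrite /p'; case: (eqVneq i a.+1) => [?|ia]; first by subst i; rewrite gE //; arith.
    by rewrite pg ?sM //; arith.
  - move=> i j im jm; rewrite /p'; have [iE|ia] := eqVneq i a.+1; have [jE|ja] := eqVneq j a.+1; try subst i; try subst j.
    + by rewrite irr_e /consecutive; arith.
    + by rewrite egp ?sM // eqxx Xs // /consecutive; arith.
    + by rewrite epg ?sM // eqxx Xs // /consecutive; arith.
    by rewrite epp ?sM // /consecutive /s; case: ifP => ?; case: ifP => ?; arith.
  - by move=> i j im jm; rewrite egg //; arith.
  - move=> i j im jm; rewrite /p' /=; case: (eqVneq j a.+1) => [?|ja]; first subst j.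
      by rewrite egg /consecutive; arith.
    by rewrite egp ?sM //; arith.
  - move=> i z im zS1 ez; apply: in_teeth' => //.
    have zS : z \in S by move: zS1; rewrite in_setD => /andP[].
    move: ez; rewrite /p'; case: (eqVneq i a.+1) => [?|ia]; first subst i; move=> ez.
      by apply: g_out ez => //; arith.
    by apply: p_out ez => //; move: im ia; rewrite /s /M'; case: ifP; arith.
  move=> i z im zS1 ez; apply: in_teeth' => //.
  have zS : z \in S by move: zS1; rewrite in_setD => /andP[].
  by apply: g_out ez => //; arith.
have a'M : a.+1 + 2 <= M' by rewrite /M'; arith.
have t'1 : 1 <= t.-1 by arith.
apply: reduces_trans red1 _; apply: (reduces_weaken (comb1_reduces sym_e irr_e comb' _ a'M t'1)) => //.
  apply/subsetP=> z; rewrite in_setD => /andP[zt zS].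
  rewrite in_setD in_setD zS andbT; apply/andP; split.
    by apply: contra zt => /teeth'.
  by apply: contra zt => /segmentP[j jm ->]; rewrite in_setU mem_segment //; arith.
move=> y z _ _.
have -> : p' 0 = p 0 by [].
have -> // : p' M' = p M.
by rewrite /p' /s /M'; case: eqP => [|_]; [arith|case: ifP => ?; [arith|congr p; arith]].
Qed.

(** The case distinction is on the first and last contacts [a] and [b] of [g t] with [p]: equal,
    consecutive, or further apart. The last two cases are turned into a single contact; the lower
    bound 3 pays for the consecutive case, which moves the contact back by one. *)
Lemma comb_reduces e S p M g t (X : pred nat) : symmetric e -> irreflexive e ->
  comb e S p M g t X -> 2 <= t -> (exists2 j, j <= M & X j) ->
  (forall j, j <= M -> X j -> 3 <= j <= M - 2) ->
  reduces e S (join (p 0) (fun z => e (p M) z (+) e (g 0) z) e)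
    (S :\: comb_teeth p M g t).
Proof.
move=> sym_e irr_e cmb t2 [j0 j0M Xj0] Xm.
have ex : exists j, (j <= M) && X j by exists j0; rewrite j0M.
have bound j : (j <= M) && X j -> j <= M by case/andP.
case: (ex_minnP ex) => a /andP[aM Xa] a_min.
case: (ex_maxnP ex bound) => b /andP[bM Xb] b_max.
have Xab j : j <= M -> X j -> a <= j <= b.
  by move=> jM Xj; rewrite a_min ?b_max // jM.
have := Xab _ aM Xa; have := Xm _ aM Xa; have := Xm _ bM Xb => bm am abb.
have [ab|ab] := leqP a.+2 b.
  by apply: (comb_reroute sym_e irr_e cmb Xa Xb Xab); arith.
have [ba|ba] := eqVneq b a.+1.
  apply: (comb2_reduces (a := a) sym_e irr_e cmb); try arith.
  move=> j jM; apply/idP/idP => [/(Xab _ jM)|/orP[]/eqP->]; rewrite -?ba //.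
  by arith.
have cmb1 : comb e S p M g t (pred1 a).
  case: cmb => [pS gS pE gE pg epp egg egp p_out g_out]; split=> //.
  move=> i j it jM; rewrite egp //; congr (_ && _).
  by apply/idP/eqP => [/(Xab _ jM)|->] //; arith.
by apply: (comb1_reduces sym_e irr_e cmb1); arith.
Qed.
End Combs.

Lemma slow_growth (f : nat -> nat) m : (forall i, i < m -> f i.+1 <= (f i).+1) ->
  forall i j, i <= j <= m -> f j <= f i + (j - i).
Proof.
move=> step i; elim=> [|j IH] ij; first by have -> : i = 0 by [arith]; rewrite addn0.
have [->|ne] := eqVneq i j.+1; first by rewrite subnn addn0.
have := IH ltac:(arith); have := step j ltac:(arith); arith.
Qed.

(** A discrete intermediate value theorem: [f] may fall arbitrarily, but it rises by at most one per
    step and so skips no value on the way up. *)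
Lemma slow_growth_hits (f : nat -> nat) m c : (forall i, i < m -> f i.+1 <= (f i).+1) ->
  f 0 <= c -> c <= f m -> exists2 i, i <= m & f i = c.
Proof.
elim: m => [|m IH] step f0 fm; first by exists 0 => //; arith.
have [le|lt] := leqP c (f m).
  by have [i im <-] := IH (fun i im => step i (ltnW im)) f0 le; exists i => //; arith.
by exists m.+1 => //; have := step m (ltnSn m); arith.
Qed.

Section Tripods.
Variable V : finType.
Implicit Types (e : rel V) (S A R T : {set V}).

Definition adjoins e T : pred V := fun x => [exists y in T, e x y].

Lemma adjoinsP e T x : reflect (exists2 y, y \in T & e x y) (adjoins e T x).
Proof. exact: exists_inP. Qed.

(* A strip A leading from the head h to T1, and a side branch R leaving A around column c
   towards T2. The columns leave enough room between c and both ends of A, and the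
   heights force R to be at least three layers deep. *)
Record tripod e S h A R T1 T2 (col ht : V -> nat) lo c hi : Prop := Tripod {
  tp_h : h \in S;
  tp_A : A \subset S;
  tp_R : R \subset S;
  tp_hAR : h \notin A :|: R;
  tp_T1 : T1 \subset S :\: (h |: (A :|: R));
  tp_T2 : T2 \subset S :\: (h |: (A :|: R));
  tp_lo : lo + 3 <= c;
  tp_hi : c + 3 <= hi;
  tp_col : forall x y, x \in A -> y \in A -> e x y -> col y <= (col x).+1;
  tp_h_col : forall x, x \in A -> e h x -> col x <= lo;
  tp_T1_col : forall x y, x \in A -> y \in T1 -> e x y -> hi <= col x;
  tp_ht0 : forall x, x \in A -> ht x = 0;
  tp_side : forall x y, x \in R :|: [set z in A | col z == c] -> y \in A -> e x y ->
    [/\ c <= (col y).+1, col y <= c.+1 & ht x <= 1];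
  tp_ht : forall x y, x \in R :|: [set z in A | col z == c] ->
    y \in R :|: [set z in A | col z == c] -> e x y -> ht x <= (ht y).+1;
  tp_T2_ht : forall x y, x \in A :|: R -> y \in T2 -> e x y -> 3 <= ht x;
  tp_h_R : forall x, x \in R -> e h x = false;
  tp_R_T1 : forall x y, x \in R -> y \in T1 -> e x y = false;
  tp_out : forall x y, x \in A :|: R -> y \in S -> e x y ->
    y \in (h |: (A :|: R)) :|: (T1 :|: T2);
  tp_link : linked e A (e h) (adjoins e T1);
  tp_branch : forall z, z \in A -> col z = c ->
    linked e (R :|: [set z in A | col z == c]) (adjoins e T2) (pred1 z) }.

(** The main path is [h] followed by a shortest path [f] through [A], and the side path [g] is a
    shortest path from the neighbours of [T2] to the vertices touching [f]. Together they form a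
    comb: [col] keeps the contacts of [g t] away from the ends of the main path, and [ht] keeps [g]
    long. *)
Lemma tripod_reduces e S h A R T1 T2 col ht lo c hi : symmetric e -> irreflexive e ->
  tripod e S h A R T1 T2 col ht lo c hi ->
  exists N : pred V, [/\ reduces e S (join h N e) (S :\: (A :|: R)),
    (forall y, N y -> y \in T1 :|: T2), (exists2 y, y \in T1 & N y)
    & exists2 y, y \in T2 & N y].
Proof.
move=> sym_e irr_e [hS AS RS hAR T1S T2S lo_c c_hi colA h_col T1_col ht0 side htR T2_ht h_R R_T1 out link branch].
have [m [f [fA f_inj f_edge f_start f_end]]] := linked_induced_path sym_e irr_e link.
set J := [set z in A | col z == c] in side htR branch.
have step i : i < m -> col (f i.+1) <= (col (f i)).+1.
  move=> im; apply: colA; rewrite ?fA ?f_edge /consecutive; arith.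
have grow := slow_growth step.
have col0 : col (f 0) <= lo by apply: h_col; rewrite ?fA ?f_start.
have colm : hi <= col (f m).
  have : adjoins e T1 (f m) by rewrite f_end.
  by move=> /adjoinsP[y yT ey]; apply: (T1_col _ _ (fA _ (leqnn m)) yT ey).
have [i0 i0m coli0] : exists2 i, i <= m & col (f i) = c.
  by apply: slow_growth_hits => //; arith.
pose touch : pred V := fun x => [exists i : 'I_m.+1, e x (f i)].
have touchP x i : i <= m -> e x (f i) -> touch x.
  by move=> im ex; apply/existsP; exists (Ordinal (im : i < m.+1)).
have no_T2 x : x \in A -> adjoins e T2 x = false.
  move=> xA; apply/adjoinsP=> -[y yT exy].
  by have := T2_ht x y; rewrite in_setU xA ht0 // => /(_ isT yT exy).
(* A path of the side branch towards [f i0] touches the main path at the latest one vertex before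
   its end. *)
have link2 : linked e (R :|: J) (adjoins e T2) touch.
  have [x [y [xR x2 /eqP yE /connectP[q xq yq]]]] := branch _ (fA _ i0m) coli0.
  subst y; case/lastP: q xq yq => [_ /= xE|q w].
    by move: x2; rewrite -xE no_T2 // fA.
  rewrite rcons_path last_rcons => /andP[xq ew] yw; subst w.
  exists x, (last x q); split=> //; last by apply/connectP; exists q.
  by case/and3P: ew => _ _; apply: touchP.
have [t [g [gR g_inj g_edge g_start g_end]]] := linked_induced_path sym_e irr_e link2.
have g_touch i j : i <= t -> j <= m -> e (g i) (f j) -> i = t.
  by move=> it jm eij; apply/eqP; rewrite -g_end //; apply: touchP eij.
have RJ x : x \in R :|: J -> x \in A :|: R.
  by rewrite !inE => /orP[->|/andP[-> _]] //; rewrite orbT.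
have g_T2 i : i <= t -> adjoins e T2 (g i) -> 3 <= ht (g i).
  by move=> it /adjoinsP[y yT ey]; apply: (T2_ht _ _ _ yT ey); apply/RJ/gR.
have fg i j : i <= m -> j <= t -> f i <> g j.
  move=> im jt fgij; case: j jt fgij => [|j] jt fgij.
    by have := no_T2 (g 0); rewrite -fgij fA // fgij g_start // => /(_ isT).
  have : j = t by apply: (@g_touch _ i); rewrite ?fgij ?g_edge /consecutive; arith.
  arith.
have ht_t : ht (g t) <= 1.
  have /existsP[i ei] : touch (g t) by rewrite g_end.
  have im : i <= m by rewrite -ltnS.
  by have [] := side _ _ (gR t (leqnn t)) (fA i im) ei.
have ht_0 : 3 <= ht (g 0) by apply: g_T2; rewrite ?g_start.
(* Heights drop by at most one per edge, from at least 3 at [g 0] to at most 1 at [g t]. *)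
have t2 : 2 <= t.
  case: t ht_t g_edge gR {link2 g_inj g_start g_end g_touch g_T2 fg} => [|[|t]] // ht_t g_edge gR; try arith.
  by have := htR _ _ (gR 0 isT) (gR 1 isT) (g_edge 0 1 isT isT); arith.
have h_side x : x \in R :|: J -> e h x = false.
  case/setUP=> [/h_R //|]; rewrite inE => /andP[xA /eqP xc].
  by apply/negP=> /(h_col _ xA); arith.
have side_T1 x y : x \in R :|: J -> y \in T1 -> e x y = false.
  case/setUP=> [xR yT|]; first exact: R_T1.
  rewrite inE => /andP[xA /eqP xc] yT.
  by apply/negP=> /(T1_col _ _ xA yT); arith.
pose p i := if i is j.+1 then f j else h.
pose S' := (S :\: (A :|: R)) :|: (segment p 0 m.+2 :|: segment g 0 t.+1).
have pA i : 0 < i <= m.+1 -> p i \in A by case: i => // i im; apply: fA; arith.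
have hA x : x \in A :|: R -> (h == x) = false.
  by move=> xA; apply/eqP=> hx; rewrite -hx (negbTE hAR) in xA.
have AR x : x \in A -> x \in A :|: R by move=> xA; rewrite in_setU xA.
have S'S : S' \subset S.
  rewrite !subUset subsetDl /=; apply/andP; split; apply/subsetP=> x /segmentP[j jm ->].
    by case: j jm => // j jm; apply: (subsetP AS); apply: fA; arith.
  have /RJ/setUP[] : g j \in R :|: J by apply: gR; arith.
    exact: (subsetP AS).
  exact: (subsetP RS).
have cmb : comb e S' p m.+1 g t (fun j => e (g t) (p j)).
  split.
  - by move=> i im; rewrite in_setU in_setU mem_segment ?orbT //; arith.
  - by move=> i im; rewrite in_setU in_setU [_ \in segment g _ _]mem_segment ?orbT //; arith.
  - move=> [|i] [|j] im jm; rewrite ?eqxx //=.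
    + by rewrite hA // AR // fA; arith.
    + by rewrite eq_sym hA // AR // fA; arith.
    by rewrite eqSS; apply/eqP/eqP => [/f_inj|->] //; apply.
  - by move=> i j im jm; apply/eqP/eqP => [/g_inj|->] //; apply.
  - move=> [|i] j im jt /=; first by rewrite hA //; apply/RJ/gR.
    by apply/eqP; apply: fg.
  - move=> [|i] [|j] im jm; rewrite /= ?irr_e //.
    + by rewrite f_start // /consecutive; arith.
    + by rewrite sym_e f_start // /consecutive; arith.
    by rewrite f_edge.
  - exact: g_edge.
  - move=> i [|j] it jm /=; first by rewrite !(sym_e _ h) !h_side ?andbF //; apply: gR.
    have [->|ne] := eqVneq i t => //; apply/negP=> /(g_touch _ _ it jm) iE.
    by rewrite iE eqxx in ne.
  - case=> // i z im /setUP[|//]; rewrite in_setD => /andP[zAR zS] /= ez.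
    have iA : f i \in A by apply: fA; arith.
    have := out _ _ (AR _ iA) zS ez; rewrite in_setU in_setU1 (negbTE zAR) orbF => /orP[/eqP->|].
      by rewrite in_setU; have := @mem_segment _ p 0 m.+2 0 isT => ->.
    case/setUP=> zT; last by have := no_T2 _ iA; move/adjoinsP; case; exists z.
    have : adjoins e T1 (f i) by apply/adjoinsP; exists z.
    by rewrite f_end; arith.
  move=> i z /andP[i_gt0 it] /setUP[|//]; rewrite in_setD => /andP[zAR zS] /= ez.
  have gi := gR i it; have := out _ _ (RJ _ gi) zS ez.
  rewrite in_setU in_setU1 (negbTE zAR) orbF => /orP[/eqP->|].
    by rewrite in_setU; have := @mem_segment _ p 0 m.+2 0 isT => ->.
  case/setUP=> zT; first by rewrite side_T1 in ez.
  have : adjoins e T2 (g i) by apply/adjoinsP; exists z.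
  by rewrite g_start; arith.
have {}cmb := comb_reduces sym_e irr_e cmb t2.
have gtRJ := gR t (leqnn t).
have fmA := fA m (leqnn m).
have g0RJ := gR 0 (leq0n t).
(* A vertex seen from both ends would be toggled twice. Vertices of [T1] are never seen from [g 0],
   nor those of [T2] from [f m], so [N] meets both feet. *)
pose N := [pred z | [&& z \in S :\: (h |: (A :|: R)) & e (f m) z (+) e (g 0) z]].
have N1 z : z \in T1 -> e (f m) z -> N z.
  by move=> zT ez; rewrite /N /= (subsetP T1S) // ez side_T1.
have N2 z : z \in T2 -> e (g 0) z -> N z.
  move=> zT ez; rewrite /N /= (subsetP T2S) // ez addbT; apply/negP=> ez'.
  by have := no_T2 _ fmA; move/adjoinsP; case; exists z.
exists N; split.
- apply: (@reduces_trans _ _ _ e S'); first exact: reduces_sub.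
  apply: (reduces_weaken (cmb _ _)).
  + have /existsP[i ei] : touch (g t) by rewrite g_end.
    by exists i.+1.
  (* A contact has column within one of [c], while [f] starts at column [c - 3] or before and ends
     at [c + 3] or beyond. At least two steps of [f] remain on either side; with the shift by [h]
     this is the required range of positions. *)
  + case=> [|j] jm ej; first by rewrite /= sym_e h_side in ej.
    have [] := side _ _ gtRJ (fA j jm) ej.
    have g1 : 0 <= j <= m by arith.
    have g2 : j <= m <= m by arith.
    have := grow _ _ g1; have := grow _ _ g2; arith.
  + apply/subsetP=> z; rewrite !in_setD => /andP[zAR zS]; rewrite !in_setU in_setD zAR zS /= andbT.
    apply: contra zAR => /orP[]/segmentP[j jm ->]; last by apply/RJ/gR; arith.
    by apply/AR/pA; arith.
  have Nz z : z \in S :\: (A :|: R) -> z != h -> N z = e (f m) z (+) e (g 0) z.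
    by rewrite /N /= !in_setD in_setU1 negb_or => /andP[-> ->] ->.
  move=> y z yS zS; rewrite /join.
  by have [->|yh] := eqVneq y h; have [->|zh] := eqVneq z h; rewrite ?addbK ?(Nz _ yS) ?(Nz _ zS).
- move=> y /andP[]; rewrite in_setD in_setU1 !negb_or => /andP[/andP[yh yAR] yS] ey.
  have : e (f m) y || e (g 0) y by move: ey; case: (e (f m) y).
  case/orP; [move/(out _ _ (AR _ fmA) yS)|move/(out _ _ (RJ _ g0RJ) yS)];
    by rewrite in_setU in_setU1 (negbTE yh) (negbTE yAR).
- have /adjoinsP[y yT ey] : adjoins e T1 (f m) by rewrite f_end.
  by exists y => //; apply: N1.
have /adjoinsP[y yT ey] : adjoins e T2 (g 0) by rewrite g_start.
by exists y => //; apply: N2.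
Qed.

End Tripods.

(** * Circuits of toggles and local complementations *)

Section Circuits.
Variable n : nat.
Implicit Types (H : rel 'I_n).

Definition toggle i j H := join i (pred1 j) H.

(** The index counts the gates, each of which will cost seven columns of the grid. *)
Inductive circuit : nat -> rel 'I_n -> Prop :=
| circuit_empty H : H =2 (fun _ _ => false) -> circuit 0 H
| circuit_toggle m H (i j : 'I_n) H' : circuit m H -> j = i.+1 :> nat ->
    H' =2 toggle i j H -> circuit m.+1 H'
| circuit_lc m H k H' : circuit m H -> H' =2 lc H k -> circuit m.+1 H'.

Lemma circuit_sym_irr m H : circuit m H -> symmetric H /\ irreflexive H.
Proof.
elim=> {m H} [H H0|m H i j H' _ [sym_H irr_H] _ E|m H k H' _ [sym_H irr_H] E].
- by split=> [x y|x]; rewrite !H0.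
- by split=> [x y|x]; rewrite !E; [apply: join_sym|apply: join_irr].
by split=> [x y|x]; rewrite !E; [apply: lc_sym|apply: lc_irr].
Qed.

Lemma circuit_ext m H H' : circuit m H -> H' =2 H -> circuit m H'.
Proof.
case=> {m H} [H H0 E|m H i j H1 c ij E1 E|m H k H1 c E1 E].
- by apply: circuit_empty => x y; rewrite E.
- by apply: (circuit_toggle c ij) => x y; rewrite E.
by apply: (circuit_lc c (k := k)) => x y; rewrite E.
Qed.

Lemma lc_row H k x : irreflexive H -> lc H k k x = H k x.
Proof. by move=> irr_H; rewrite /lc irr_H addbF. Qed.

Lemma toggle_row H k i x : k != i -> toggle k i H k x = H k x (+) (x == i).
Proof. by move=> ki; rewrite /toggle /join eqxx /= (negbTE ki) andbF addbF. Qed.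

(* The number of edges of the clique on N(k) is a quadratic form in N(k); its second
   difference in the directions i and j is the single edge ij. *)
Lemma toggle_commutator H i j k : symmetric H -> irreflexive H ->
  k != i -> k != j -> i != j ->
  toggle k j (lc (toggle k i (lc (toggle k j (lc (toggle k i (lc H k)) k)) k)) k)
  =2 toggle i j H.
Proof.
move=> sym_H irr_H ki kj ij x y.
pose H1 := lc H k; pose H2 := toggle k i H1; pose H3 := lc H2 k.
pose H4 := toggle k j H3; pose H5 := lc H4 k; pose H6 := toggle k i H5; pose H7 := lc H6 k.
have irr1 : irreflexive H1 by apply: lc_irr.
have irr2 : irreflexive H2 by apply: join_irr.
have irr3 : irreflexive H3 by apply: lc_irr.
have irr4 : irreflexive H4 by apply: join_irr.
have irr5 : irreflexive H5 by apply: lc_irr.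
have irr6 : irreflexive H6 by apply: join_irr.
have r2 z : H2 k z = H k z (+) (z == i) by rewrite /H2 toggle_row // /H1 lc_row.
have r4 z : H4 k z = H k z (+) (z == i) (+) (z == j) by rewrite /H4 toggle_row // /H3 lc_row // r2.
have r6 z : H6 k z = H k z (+) (z == j).
  by rewrite /H6 toggle_row // /H5 lc_row // r4 addbAC addbK.
rewrite -/H1 -/H2 -/H3 -/H4 -/H5 -/H6 -/H7.
rewrite {1}/toggle /join {1}/H7 /lc !r6 {1}/H6 /toggle /join {1}/H5 /lc !r4.
rewrite {1}/H4 /toggle /join {1}/H3 /lc !r2 {1}/H2 /toggle /join {1}/H1 /lc /=.
have [->|xi] := eqVneq x i; have [->|yi] := eqVneq y i; rewrite ?(negbTE ij) ?eqxx ?[_ == k]eq_sym ?(negbTE ki) ?(negbTE kj) /=.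
- by rewrite !andbF !addbF.
- by case: (H i y); case: (H k i); case: (H k y); case: (k == y); case: (y == j).
- by rewrite xi; case: (H x i); case: (H k i); case: (H k x); case: (k == x); case: (x == j).
by case: (H x y); case: (H k x); case: (H k y); case: (x != y); case: (k == x);
  case: (k == y); case: (x == j); case: (y == j).
Qed.

(** Induction on the distance: for [k] just before [j], the commutator uses only the consecutive
    toggle of [k] and [j], the shorter toggle of [i] and [k], and local complementations at [k]. *)
Lemma circuit_toggles d m H (i j : 'I_n) : circuit m H -> j = i + d.+1 :> nat ->
  exists m', circuit m' (toggle i j H).
Proof.
elim: d m H i j => [|d IH] m H i j c ijd.
  by exists m.+1; apply: (circuit_toggle c) => //; rewrite ijd addn1.
have kn : i + d.+1 < n by have := ltn_ord j; lia.
pose k := Ordinal kn.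
have ki : k != i by rewrite -val_eqE /=; lia.
have kj : k != j by rewrite -val_eqE /=; lia.
have ij : i != j by rewrite -val_eqE /=; lia.
have [sym_H irr_H] := circuit_sym_irr c.
have tog_i m1 H1 : circuit m1 H1 -> exists m2, circuit m2 (toggle k i H1).
  move=> c1; have [m2 c2] := IH _ _ i k c1 erefl.
  by exists m2; apply: (circuit_ext c2) => x y; rewrite /toggle /join addbAC; congr (_ (+) _ (+) _); rewrite andbC.
have tog_j m1 H1 : circuit m1 H1 -> exists m2, circuit m2 (toggle k j H1).
  by move=> c1; exists m1.+1; apply: (circuit_toggle c1) => //=; move: (ijd) => /= ?; lia.
have lck m1 H1 : circuit m1 H1 -> exists m2, circuit m2 (lc H1 k).
  by move=> c1; exists m1.+1; apply: (circuit_lc c1).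
have [_ /tog_i [_ /lck [_ /tog_j [_ /lck [_ /tog_i [_ /lck [_ /tog_j [m' c']]]]]]]] := lck _ _ c.
exists m'; apply: (circuit_ext c') => x y.
by rewrite toggle_commutator.
Qed.

(** Induction on the number of edges: toggling an edge removes it, and toggling it once more after
    the circuit for the smaller graph restores it. *)
Lemma circuit_all H : symmetric H -> irreflexive H -> exists m, circuit m H.
Proof.
move: {2}#|_| (leqnn #|[pred p | H p.1 p.2]|) => b.
elim: b H => [|b IH] H leb sym_H irr_H.
  exists 0; apply: circuit_empty => x y; apply/negbTE/negP=> xy.
  by move: leb; rewrite leqn0 => /eqP/card0_eq/(_ (x, y)); rewrite inE /= xy.
have [/existsP[i /existsP[j /andP[ij Hij]]]|none] :=
    boolP [exists i : 'I_n, exists j : 'I_n, (i < j) && H i j]; last first.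
  exists 0; apply: circuit_empty => x y; apply/negbTE/negP=> xy.
  case: (ltngtP x y) => [lt|gt|eq].
  - by case/negP: none; apply/existsP; exists x; apply/existsP; exists y; rewrite lt.
  - by case/negP: none; apply/existsP; exists y; apply/existsP; exists x; rewrite gt sym_H.
  by move: xy; rewrite (val_inj eq) irr_H.
have i_ne_j : i != j by rewrite -val_eqE /=; lia.
have [|m c] := IH (toggle i j H) _ (join_sym _ _ sym_H) (join_irr _ _ irr_H).
  rewrite -ltnS; apply: leq_trans leb; apply/proper_card/properP; split.
    apply/subsetP=> -[x y]; rewrite !inE /toggle /join /=.
    have [->|xi] := eqVneq x i; have [->|yi] := eqVneq y i; rewrite ?addbF //=.
    - by rewrite (negbTE i_ne_j) !addbF.
    - by have [->|] := eqVneq y j; rewrite ?Hij ?addbF.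
    by have [->|] := eqVneq x j; rewrite ?(sym_H j i) ?Hij ?addbF.
  by exists (i, j); rewrite !inE /= ?Hij // /toggle /join Hij /= !eqxx eq_sym (negbTE i_ne_j).
have [m' c'] := @circuit_toggles (j - i.+1) _ _ i j c ltac:(lia).
exists m'; apply: (circuit_ext c') => x y.
by rewrite /toggle /join; case: (H x y); case: (_ && _); case: (_ && _).
Qed.

End Circuits.

(** * Executing a circuit in a grid model *)

Section GridModels.
Variable V : finType.
Implicit Types (e : rel V) (S A R T : {set V}).

Lemma chain_connect e (D : {set V}) (B : nat -> {set V}) m :
  (forall i, i <= m -> B i \subset D) ->
  (forall i x y, i <= m -> x \in B i -> y \in B i -> connect (within (B i) e) x y) ->
  (forall i, i < m -> exists x y, [/\ x \in B i, y \in B i.+1 & e x y]) ->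
  forall x y, x \in B 0 -> y \in B m -> connect (within D e) x y.
Proof.
elim: m => [|m IH] BD conn edge x y x0 ym.
  by apply: (@connect_within_sub _ _ (B 0)); [apply: BD|apply: conn].
have [u [v [uB vB euv]]] := edge m (ltnSn m).
have xu : connect (within D e) x u.
  apply: IH => // [i im|i a b im|i im]; [apply: BD|apply: conn|apply: edge]; exact: ltnW.
apply: connect_trans xu _; apply: (@connect_trans _ _ v); last first.
  by apply: (@connect_within_sub _ _ (B m.+1)); [apply: BD|apply: conn].
by apply: connect1; apply/and3P; rewrite (subsetP (BD _ (leqnSn m)) _ uB) (subsetP (BD _ (leqnn _)) _ vB).
Qed.

Definition grid_cell (placed : pred V) (row col : V -> nat) r c : {set V} :=
  [set x | [&& placed x, row x == r & col x == c]].

(** Diagonal neighbours are excluded, whereas equal cells are included to allow for edges inside a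
    branch set. *)
Definition near r c r' c' :=
  [|| [&& r == r', c <= c'.+1 & c' <= c.+1] | [&& c == c', r <= r'.+1 & r' <= r.+1]].

(* A K x K grid as an induced minor: the branch set in row r and column c is grid_cell r c, and
   the vertices outside the branch sets are not placed. *)
Record grid_model e (placed : pred V) (row col : V -> nat) K : Prop := GridModel {
  gm_near : forall x y, placed x -> placed y -> e x y -> near (row x) (col x) (row y) (col y);
  gm_conn : forall r c x y, r < K -> c < K -> x \in grid_cell placed row col r c ->
    y \in grid_cell placed row col r c -> connect (within (grid_cell placed row col r c) e) x y;
  gm_right : forall r c, r < K -> c.+1 < K -> exists x y,
    [/\ x \in grid_cell placed row col r c, y \in grid_cell placed row col r c.+1 & e x y];
  gm_down : forall r c, r.+1 < K -> c < K -> exists x y,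
    [/\ x \in grid_cell placed row col r c, y \in grid_cell placed row col r.+1 c & e x y] }.

Variables (e0 : rel V) (placed : pred V) (row col : V -> nat) (K : nat).
Hypothesis sym0 : symmetric e0.
Hypothesis model : grid_model e0 placed row col K.

Local Notation cell := (grid_cell placed row col).

Definition cells (P : nat -> nat -> bool) : {set V} := [set x | placed x && P (row x) (col x)].

Lemma cell_cells (P : nat -> nat -> bool) r c : P r c -> cell r c \subset cells P.
Proof. by move=> Prc; apply/subsetP=> x; rewrite !inE => /and3P[-> /eqP-> /eqP->]. Qed.

Lemma cell_edge r c r' c' : r < K -> c < K -> r' < K -> c' < K ->
  ((r == r') && ((c' == c.+1) || (c == c'.+1))) || ((c == c') && ((r' == r.+1) || (r == r'.+1))) ->
  exists x y, [/\ x \in cell r c, y \in cell r' c' & e0 x y].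
Proof.
move=> rK cK r'K c'K.
have sw a b a' b' : (exists x y, [/\ x \in cell a b, y \in cell a' b' & e0 x y]) ->
    exists x y, [/\ x \in cell a' b', y \in cell a b & e0 x y].
  by case=> x [y [xa ya exy]]; exists y, x; split=> //; rewrite sym0.
case/orP=> /andP[/eqP E /orP[]/eqP E']; subst.
- exact: (gm_right model).
- by apply: sw; apply: (gm_right model).
- exact: (gm_down model).
by apply: sw; apply: (gm_down model).
Qed.

Lemma within_eq (D : {set V}) e e' : {in D &, e =2 e'} ->
  connect (within D e) =2 connect (within D e').
Proof.
move=> ee' x y; apply: eq_connect => u v.
by apply/and3P/and3P=> -[uD vD]; [rewrite ee'|rewrite -ee'].
Qed.

Definition dist a b := (a - b) + (b - a).

Definition side (down : bool) r0 r := if down then r0 < r else r < r0.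

Lemma in_cells (P : nat -> nat -> bool) x : (x \in cells P) = placed x && P (row x) (col x).
Proof. by rewrite inE. Qed.

Lemma in_cell r c x : (x \in cell r c) = [&& placed x, row x == r & col x == c].
Proof. by rewrite inE. Qed.

Definition strip (r0 l hi r c : nat) := (r == r0) && (l <= c <= hi).
Definition branch down (r0 cc k r c : nat) := [&& side down r0 r, dist r r0 <= k & c == cc].

(** The height of a vertex is its distance to row [r0]. [outer] adds one cell at the tip of the
    strip and one at the tip of the branch, and these two cells are the feet. Depth 3 of the inner
    branch is what forces height at least 3 next to the foot [T2]. *)
Lemma strip_tripod e S h down r0 l cc hi : symmetric e -> irreflexive e ->
  let inner r c := strip r0 l hi r c || branch down r0 cc 3 r c in
  let outer r c := strip r0 l hi.+1 r c || branch down r0 cc 4 r c in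
  l + 3 <= cc -> cc + 3 <= hi -> hi.+1 < K ->
  (if down then r0 + 4 < K else (4 <= r0) && (r0 < K)) ->
  cells outer \subset S -> {in cells outer &, e =2 e0} ->
  h \in S -> h \notin cells outer ->
  (forall x y, x \in cells inner -> y \in S -> e x y -> (y == h) || (y \in cells outer)) ->
  (forall x, x \in cells inner -> e h x -> x \in cell r0 l) ->
  (exists2 x, x \in cell r0 l & e h x) ->
  exists N : pred V,
    [/\ reduces e S (join h N e) (S :\: cells inner),
        (forall y, N y -> y \in cells outer :\: cells inner),
        (exists2 y, y \in cell r0 hi.+1 & N y)
      & exists2 y, y \in cells (branch down r0 cc 4) & N y].
Proof.
move=> sym_e irr_e inner outer l_cc cc_hi hiK r0K outS e_e0 hS h_out nbr h_nbr [x0 x0c hx0].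
pose A := cells (strip r0 l hi); pose R := cells (branch down r0 cc 3).
pose T1 := cell r0 hi.+1.
pose T2 := cells (fun r c => branch down r0 cc 4 r c && (dist r r0 == 4)).
have innerE : cells inner = A :|: R.
  by apply/setP=> x; rewrite in_setU !in_cells -andb_orr.
have sub_cells (P Q : nat -> nat -> bool) : (forall r c, P r c -> Q r c) -> cells P \subset cells Q.
  by move=> PQ; apply/subsetP=> x; rewrite !in_cells => /andP[-> /PQ].
have inner_outer : cells inner \subset cells outer.
  by apply: sub_cells => r c; rewrite /inner /outer /strip /branch; case: side; arith.
have AI : A \subset cells inner by apply: sub_cells => r c; rewrite /inner => ->.
have RI : R \subset cells inner by apply: sub_cells => r c; rewrite /inner orbC => ->.
have sideE r : side down r0 r -> r != r0 by rewrite /side; case: (down); arith.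
have T1out : T1 \subset cells outer :\: cells inner.
  apply/subsetP=> x; rewrite in_setD !in_cells in_cell => /and3P[-> /eqP-> /eqP->].
  rewrite /inner /outer /strip /branch; case E: (side down r0 r0); last by arith.
  by have := sideE _ E; rewrite eqxx.
have T2out : T2 \subset cells outer :\: cells inner.
  apply/subsetP=> x; rewrite in_setD !in_cells => /andP[-> /andP[]].
  rewrite /inner /outer /strip /branch => /and3P[sd d4 cx] d; have := sideE _ sd.
  by rewrite sd; arith.
have e_near x y : x \in cells outer -> y \in cells outer -> e x y -> near (row x) (col x) (row y) (col y).
  move=> xo yo; rewrite e_e0 //; move: xo yo; rewrite !in_cells => /andP[px _] /andP[py _].
  exact: (gm_near model).
have AO x : x \in A -> x \in cells outer by move=> xA; apply/(subsetP inner_outer)/(subsetP AI).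
have RO x : x \in R -> x \in cells outer by move=> xA; apply/(subsetP inner_outer)/(subsetP RI).
have T1O x : x \in T1 -> x \in cells outer by move/(subsetP T1out)/setDP=> [].
have T2O x : x \in T2 -> x \in cells outer by move/(subsetP T2out)/setDP=> [].
have AP x : x \in A -> [/\ placed x, row x = r0, l <= col x & col x <= hi].
  by rewrite in_cells /strip => /and4P[-> /eqP-> -> ->].
have RP x : x \in R -> [/\ placed x, row x != r0, dist (row x) r0 <= 3 & col x = cc].
  by rewrite in_cells => /and4P[-> /sideE-> -> /eqP->].
have T1P x : x \in T1 -> row x = r0 /\ col x = hi.+1.
  by rewrite in_cell => /and3P[_ /eqP-> /eqP->].
have T2P x : x \in T2 -> dist (row x) r0 = 4 /\ col x = cc.
  by rewrite in_cells => /andP[_ /andP[/and3P[_ _ /eqP->] /eqP->]].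
(* The row at depth [d] of the branch; for [d <= 4] the subtraction is exact, by the hypothesis on
   [r0]. *)
pose rho d := if down then r0 + d else r0 - d.
have rhoK d : d <= 4 -> rho d < K by move: r0K; rewrite /rho; case: (down); arith.
have rho_dist d : d <= 4 -> dist (rho d) r0 = d by move: r0K; rewrite /rho /dist; case: (down); arith.
have rho_side d : 0 < d <= 4 -> side down r0 (rho d) by move: r0K; rewrite /rho /side; case: (down); arith.
have rho_next d : d < 4 -> (rho d.+1 == (rho d).+1) || (rho d == (rho d.+1).+1).
  by move: r0K; rewrite /rho; case: (down); arith.
pose J := [set z in A | col z == cc].
have [r0_lt_K l_lt_K cc_lt_K] : [/\ r0 < K, hi < K & cc < K].
  by move: r0K; case: (down); split; arith.
have JP x : x \in R :|: J -> [/\ x \in cells outer, dist (row x) r0 <= 3, col x = cc & (row x == r0) = (x \in A)].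
  move=> xRJ; split.
  - by case/setUP: xRJ => [/RO|] //; rewrite inE => /andP[/AO].
  - case/setUP: xRJ => [/RP[]|] //; rewrite inE => /andP[/AP[_ -> _ _] _]; rewrite /dist; arith.
  - by case/setUP: xRJ => [/RP[]|] //; rewrite inE => /andP[_ /eqP].
  case/setUP: xRJ => [xR|]; last by rewrite inE => /andP[xA _]; have [_ -> _ _] := AP _ xA; rewrite xA eqxx.
  have [_ /negbTE rx _ _] := RP _ xR; rewrite rx; apply/esym/negbTE/negP=> /AP[_ rx' _ _].
  by rewrite rx' eqxx in rx.
have /tripod_reduces : tripod e S h A R T1 T2 col (fun x => dist (row x) r0) l cc hi.
  split=> //.
  - exact: subset_trans AI (subset_trans inner_outer outS).
  - exact: subset_trans RI (subset_trans inner_outer outS).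
  - by rewrite -innerE; apply: contra h_out => /(subsetP inner_outer).
  - apply/subsetP=> x xT; have := subsetP T1out _ xT; rewrite in_setD -innerE => /andP[xi xo].
    rewrite in_setD in_setU1 negb_or xi (subsetP outS) // !andbT.
    by apply: contraNneq h_out => <-.
  - apply/subsetP=> x xT; have := subsetP T2out _ xT; rewrite in_setD -innerE => /andP[xi xo].
    rewrite in_setD in_setU1 negb_or xi (subsetP outS) // !andbT.
    by apply: contraNneq h_out => <-.
  - move=> x y xA yA /(e_near _ _ (AO _ xA) (AO _ yA)).
    by have [_ -> _ _] := AP _ xA; have [_ -> _ _] := AP _ yA; rewrite /near; arith.
  - move=> x xA /(h_nbr _ (subsetP AI _ xA)); rewrite in_cell => /and3P[_ _ /eqP->]; arith.
  - move=> x y xA yT /(e_near _ _ (AO _ xA) (T1O _ yT)).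
    by have [_ -> _ _] := AP _ xA; have [-> ->] := T1P _ yT; rewrite /near; arith.
  - by move=> x /AP[_ -> _ _]; rewrite /dist subnn.
  - move=> x y xRJ yA; have [xo dx cx rx] := JP _ xRJ.
    move/(e_near _ _ xo (AO _ yA)); have [_ -> _ _] := AP _ yA; rewrite cx /near => nr.
    by split; move: nr; rewrite /dist; arith.
  - move=> x y xRJ yRJ; have [xo dx cx _] := JP _ xRJ; have [yo dy cy _] := JP _ yRJ.
    by move/(e_near _ _ xo yo); rewrite cx cy /near /dist; arith.
  - move=> x y /setUP[xA|xR] yT; [move/(e_near _ _ (AO _ xA) (T2O _ yT))|move/(e_near _ _ (RO _ xR) (T2O _ yT))];
      have [dy cy] := T2P _ yT.
      have [_ rx _ _] := AP _ xA; move: dy; rewrite rx cy /near /dist; arith.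
    have [_ rx dx cx] := RP _ xR; move: dy rx dx; rewrite cx cy /near /dist; arith.
  - move=> x xR; apply/negP=> /(h_nbr _ (subsetP RI _ xR)); rewrite in_cell => /and3P[_ rx _].
    by have [_ /negbTE] := RP _ xR; rewrite rx.
  - move=> x y xR yT; apply/negP=> /(e_near _ _ (RO _ xR) (T1O _ yT)).
    have [_ rx dx cx] := RP _ xR; have [ry cy] := T1P _ yT.
    by move: rx dx; rewrite cx cy ry /near /dist; arith.
  - move=> x y xAR yS exy.
    have xi : x \in cells inner by rewrite innerE.
    have /orP[/eqP->|yo] := nbr _ _ xi yS exy; first by rewrite in_setU in_setU1 eqxx.
    have : (y \in cells inner) || (y \in T1 :|: T2).
      move: yo; rewrite in_setU in_cell !in_cells /inner /outer /strip /branch => /andP[->] /=.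
      by case: side; arith.
    by rewrite innerE => yAR; rewrite in_setU in_setU1; case/orP: yAR => ->; rewrite ?orbT.
  - have lhi : l <= hi by arith.
    have [x' [y' [x'c y'c exy]]] := @cell_edge r0 hi r0 hi.+1 r0_lt_K l_lt_K r0_lt_K hiK ltac:(arith).
    have x'A : x' \in A by apply: (subsetP (cell_cells _)) x'c; rewrite /strip; arith.
    exists x0, x'; split=> //.
    + by apply: (subsetP (cell_cells _)) x0c; rewrite /strip; arith.
    + by apply/adjoinsP; exists y' => //; rewrite e_e0 //; [apply: AO|apply: T1O].
    have -> : connect (within A e) x0 x' = connect (within A e0) x0 x'.
      by apply: within_eq => u v uA vA; apply: e_e0; apply: AO.
    apply: (@chain_connect e0 A (fun i => cell r0 (l + i)) (hi - l)).
    + by move=> i im; apply: cell_cells; rewrite /strip; arith.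
    + by move=> i x y im; apply: (gm_conn model) => //; arith.
    + by move=> i im; apply: cell_edge; arith.
    + by rewrite addn0.
    by rewrite subnKC.
  move=> z zA zc.
  have [x' [y' [x'c y'c exy]]] := @cell_edge (rho 3) cc (rho 4) cc (rhoK 3 isT) cc_lt_K (rhoK 4 isT) cc_lt_K
    ltac:(have := rho_next 3 isT; arith).
  have rho0 : rho 0 = r0 by rewrite /rho; case: (down); arith.
  have x'R : x' \in R.
    by apply: (subsetP (cell_cells _)) x'c; rewrite /branch rho_side // rho_dist // eqxx.
  have y'T : y' \in T2.
    by apply: (subsetP (cell_cells _)) y'c; rewrite /branch rho_side // rho_dist // eqxx.
  exists x', z; split.
  - by rewrite in_setU x'R.
  - by apply/adjoinsP; exists y' => //; rewrite e_e0 //; [apply: RO|apply: T2O].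
  - by rewrite /= eqxx.
  have -> : connect (within (R :|: J) e) x' z = connect (within (R :|: J) e0) x' z.
    by apply: within_eq => u v uA vA; apply: e_e0; [have [] := JP _ uA|have [] := JP _ vA].
  (* The chain of cells runs from depth 3 to depth 0, where the cell lies in [J] instead of [R]. *)
  apply: (@chain_connect e0 (R :|: J) (fun i => cell (rho (3 - i)) cc) 3) => //.
  - move=> i im; have [i3|i3] := eqVneq i 3.
      rewrite i3 subnn rho0; apply: subset_trans (subsetUr _ _).
      apply/subsetP=> x; rewrite in_cell inE in_cells /strip => /and3P[-> /eqP-> /eqP->]; arith.
    apply: subset_trans (subsetUl _ _); apply: cell_cells.
    by rewrite /branch rho_side ?rho_dist ?eqxx ?andbT; arith.
  - by move=> i x y im; apply: (gm_conn model) => //; apply: rhoK; arith.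
  - move=> i im; apply: cell_edge => //; try (apply: rhoK; arith).
    have -> : 3 - i = (3 - i.+1).+1 by arith.
    have d4 : 3 - i.+1 < 4 by arith.
    by have := rho_next _ d4; arith.
  have [pz rz _ _] := AP _ zA.
  by rewrite in_cell subnn rho0 pz rz zc !eqxx.
case=> // N [red NP N1 [y2 y2T Ny2]].
exists N; split=> //.
- by rewrite innerE.
- by move=> y /NP/setUP[/(subsetP T1out)|/(subsetP T2out)].
exists y2 => //; apply: (subsetP _ _ y2T).
by apply: sub_cells => r c /andP[].
Qed.

End GridModels.

(** * Gates acting on the wires *)

Section Wires.
Variable V : finType.
Variables (e0 : rel V) (placed : pred V) (row col : V -> nat) (K : nat).
Hypothesis sym0 : symmetric e0.
Hypothesis model : grid_model e0 placed row col K.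

Local Notation cell := (grid_cell placed row col).
Local Notation cells := (cells placed row col).
Local Notation alive L := (cells (fun r c => L r <= c)).

Variable n : nat.
Hypothesis rows_K : 9 * n <= K.

(* Wire i runs along row 9i; the part of row r left of column L r is used up. The heads carry
   the graph H, and head i is attached to the first remaining branch set of wire i only. *)
Record wired C (H : rel 'I_n) (L : nat -> nat) (hd : 'I_n -> V) e : Prop := Wired {
  wd_sym : symmetric e;
  wd_irr : irreflexive e;
  wd_L : forall r, L r <= C;
  wd_inj : injective hd;
  wd_out : forall i, hd i \notin alive L;
  wd_hh : forall i j, e (hd i) (hd j) = H i j;
  wd_cc : {in alive L &, e =2 e0};
  wd_hc : forall (i : 'I_n) x, x \in alive L -> e (hd i) x -> x \in cell (9 * i) (L (9 * i));
  wd_touch : forall i : 'I_n, exists2 x, x \in cell (9 * i) (L (9 * i)) & e (hd i) x }.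

Definition live (L : nat -> nat) (hd : 'I_n -> V) : {set V} := [set hd i | i in 'I_n] :|: alive L.

Lemma liveP L hd x : reflect ((exists i, x = hd i) \/ x \in alive L) (x \in live L hd).
Proof.
apply: (iffP setUP) => -[].
- by case/imsetP=> i _ ->; left; exists i.
- by right.
- by case=> i ->; left; apply: imset_f.
by right.
Qed.

Lemma alive_sub (L L' : nat -> nat) : (forall r, L r <= L' r) -> alive L' \subset alive L.
Proof.
move=> LL'; apply/subsetP=> x; rewrite !in_cells => /andP[-> /=].
exact: leq_trans.
Qed.

Lemma live_sub (L L' : nat -> nat) hd : (forall r, L r <= L' r) -> live L' hd \subset live L hd.
Proof. by move=> LL'; apply: setUS; apply: alive_sub. Qed.

(** The rows without a wire are first cleared up to column [C + 6], so that the strip of wire [i]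
    meets only its own head and its continuation in column [C + 7]. Then [shift_head] makes a vertex
    of the first cell of the strip the new head. *)
Lemma lc_gate C H L hd e (i : 'I_n) : wired C H L hd e -> C + 7 < K ->
  exists L' hd' e', reduces e (live L hd) e' (live L' hd') /\
    wired (C + 7) (lc H i) L' hd' e'.
Proof.
case=> sym_e irr_e LC hd_inj hd_out e_hh e_cc e_hc touch CK.
pose h := hd i; pose C' := C + 7; pose r0 := 9 * i.
have r0K : r0 < K by have := ltn_ord i; rewrite /r0; arith.
pose L1 r := if 9 %| r then L r else C'.
pose L' r := if (9 %| r) && (r != r0) then L r else C'.
have LL1 r : L r <= L1 r by rewrite /L1; case: ifP => // _; apply: leq_trans (LC r) _; rewrite /C'; arith.
have L1L' r : L1 r <= L' r.
  by rewrite /L1 /L'; case: (9 %| r) => //=; case: ifP => // _; apply: leq_trans (LC r) _; rewrite /C'; arith.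
have LL' r : L r <= L' r by apply: leq_trans (L1L' r).
pose S1 := live L1 hd.
have red1 : reduces e (live L hd) e S1 by apply: reduces_sub => //; apply: live_sub.
pose D := cells (strip r0 (L r0) (C + 6)).
have LC0 := LC r0.
have DP x : x \in D -> [/\ placed x, row x = r0, L r0 <= col x & col x <= C + 6].
  by rewrite in_cells /strip => /and4P[-> /eqP-> -> ->].
have D1 x : x \in D -> x \in alive L1.
  by case/DP=> px rx cx _; rewrite in_cells px rx /L1 /r0 dvdn_mulr.
have A1 x : x \in alive L1 -> x \in alive L by apply: (subsetP (alive_sub LL1)).
have A' x : x \in alive L' -> x \in alive L by apply: (subsetP (alive_sub LL')).
have A'1 x : x \in alive L' -> x \in alive L1 by apply: (subsetP (alive_sub L1L')).
have D' x : x \in D -> x \notin alive L'.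
  by case/DP=> px rx _ cx; rewrite in_cells px rx /L' eqxx andbF /= /C'; arith.
have hdA j x : x \in alive L -> (x == hd j) = false.
  by move=> xA; apply/eqP => E; move: (hd_out j); rewrite -E xA.
have nbr x y : x \in D -> y \in S1 -> y != h -> e x y ->
    [/\ y \in alive L1, row y = r0, L r0 <= col y & col y <= (col x).+1].
  move=> xD /liveP[[j ->]|y1] yh exy.
    have := e_hc j x (A1 _ (D1 _ xD)); rewrite sym_e => /(_ exy).
    have [_ rx _ _] := DP _ xD; rewrite in_cell rx => /and3P[_ /eqP ij _].
    by case/eqP: yh; congr hd; apply: val_inj; move: ij; rewrite /r0 /=; arith.
  have [px rx lx cx] := DP _ xD; have := y1; rewrite {1}in_cells => /andP[py ly].
  have := gm_near model px py; rewrite -(e_cc _ _ (A1 _ (D1 _ xD)) (A1 _ y1)) => /(_ exy); rewrite rx /near => nr.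
  have [ry|ry] := eqVneq (row y) r0.
    have L1r0 : L1 r0 = L r0 by rewrite /L1 dvdn_mulr.
    by move: ly nr; rewrite ry L1r0 => ly nr; split=> //; arith.
  have nd : (9 %| row y) = false by move: nr ry; rewrite /r0; arith.
  by move: ly; rewrite /L1 nd /C'; move: nr ry; arith.
have hD : h \notin D by apply/negP=> /D1/A1; rewrite (negbTE (hd_out i)).
have hS1 : h \in S1 by apply/liveP; left; exists i.
have DS1 : D \subset S1 by apply/subsetP=> x xD; apply/liveP; right; apply: D1.
have h_nbr x : x \in D -> e h x -> col x = L r0.
  by move=> xD /(e_hc i x (A1 _ (D1 _ xD))); rewrite in_cell => /and3P[_ _ /eqP].
have inD y : y \in alive L1 -> row y = r0 -> L r0 <= col y -> col y <= C + 6 -> y \in D.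
  by rewrite /D !in_cells => /andP[-> _] -> l1 l2; rewrite /strip eqxx l1.
have [x0 x0c hx0] := touch i.
have cellK r c x : x \in cell r c -> [/\ placed x, row x = r & col x = c].
  by rewrite in_cell => /and3P[-> /eqP-> /eqP->].
have e_D : {in D &, e =2 e0} by move=> u v uD vD; apply: e_cc; apply/A1/D1.
have link : linked e D (e h) (fun x => [exists y in S1 :\: (h |: D), e x y]).
  have [x' [y' [x'c y'c exy]]] := @cell_edge _ _ _ _ _ _ sym0 model r0 (C + 6) r0 (C + 7) r0K ltac:(arith) r0K ltac:(arith) ltac:(arith).
  have y'A : y' \in alive L1.
    have [py ry cy] := cellK _ _ _ y'c; rewrite in_cells py ry cy /L1 /r0 dvdn_mulr //=.
    by move: LC0; rewrite /r0; arith.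
  have x'D : x' \in D.
    by have [py ry cy] := cellK _ _ _ x'c; rewrite in_cells py ry cy /strip eqxx; arith.
  have x0D : x0 \in D.
    by have [py ry cy] := cellK _ _ _ x0c; rewrite in_cells py ry cy /strip eqxx /r0; move: LC0; rewrite /r0; arith.
  exists x0, x'; split=> //.
    apply/exists_inP; exists y'; last by rewrite e_cc //; [apply/A1/D1|apply/A1].
    rewrite in_setD in_setU1 negb_or hdA ?A1 //=; apply/andP; split; last by apply/liveP; right.
    by apply/negP=> /DP[_ _ _]; have [_ _ ->] := cellK _ _ _ y'c; arith.
  rewrite (within_eq e_D).
  apply: (@chain_connect _ e0 D (fun k => cell r0 (L r0 + k)) (C + 6 - L r0)).
  - by move=> k km; apply: cell_cells; rewrite /strip; arith.
  - by move=> k x y km; apply: (gm_conn model); arith.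
  - by move=> k km; apply: (cell_edge sym0 model); arith.
  - by rewrite addn0.
  by rewrite subnKC //; arith.
have := @shift_head _ e S1 h D sym_e irr_e hS1 DS1 hD _ _ link.
case.
(* Neighbours of the head lie in column [L r0], so two further steps reach at most column
   [L r0 + 2], still inside the strip. *)
- move=> x y xD hx yS yh exy; have [yA ry l1 l2] := nbr _ _ xD yS yh exy.
  by apply: inD => //; rewrite (h_nbr _ xD hx) in l2; arith.
- move=> x y z xD hx yD exy zS zh eyz; have [zA rz l1 l2] := nbr _ _ yD zS zh eyz.
  have yh : y != h by rewrite hdA // A1 // D1.
  have [_ _ _ l3] := nbr _ _ xD (subsetP DS1 _ yD) yh exy.
  by apply: inD => //; rewrite (h_nbr _ xD hx) in l3; arith.
move=> h' [N [red2 h'D hh' NP [y0 Ny0]]].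
have cell' y : y \in alive L1 -> y \notin D -> (exists2 x, x \in D & e x y) -> y \in cell r0 C'.
  move=> yA yD [x xD exy].
  have yh : y != h by rewrite hdA // A1.
  have yS : y \in S1 by apply/liveP; right.
  have [_ ry l1 l2] := nbr _ _ xD yS yh exy.
  have [_ _ _ cx] := DP _ xD.
  move: (yA); rewrite in_cells in_cell ry eqxx => /andP[-> _] /=.
  apply: contraR yD => cy; apply: inD => //; move: cy; rewrite /C'; arith.
have Ncell y : N y -> y \in cell r0 C'.
  move=> /NP[yS yD yh [x xD exy]]; have [yA _ _ _] := nbr _ _ xD yS yh exy.
  by apply: cell' => //; exists x.
have h'out x : x \in S1 -> x \notin D -> x != h -> e h' x = false.
  move=> xS xD xh; apply/negP=> ex; have [xA rx l1 l2] := nbr _ _ h'D xS xh ex.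
  by move/negP: xD; apply; apply: inD => //; rewrite (h_nbr _ h'D hh') in l2; arith.
have cellA' : forall y, y \in cell r0 C' -> y \in alive L'.
  by move=> y /cellK[py ry cy]; rewrite in_cells py ry cy /L' eqxx andbF /=.
have L'j (j : 'I_n) : j != i -> L' (9 * j) = L (9 * j).
  move=> ji; rewrite /L' dvdn_mulr //= ifT //.
  by apply: contra ji => /eqP E; rewrite -val_eqE /=; move: E; rewrite /r0; arith.
have L'i : L' (9 * i) = C' by rewrite /L' -/r0 eqxx andbF.
pose hd' j := if j == i then h' else hd j.
have h'A : h' \in alive L by apply/A1/D1.
have h'hd j : (h' == hd j) = false by apply: hdA.
have hdh' j : (hd j == h') = false by rewrite eq_sym.
have N_hd j : N (hd j) = false.
  by apply/negP=> /Ncell/cellA'/A'; rewrite (negbTE (hd_out j)).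
have hdS1 j : hd j \in S1 by apply/liveP; left; exists j.
have hdD j : hd j \notin D by apply: contra (hd_out j) => /D1/A1.
have h'_hd j : j != i -> e h' (hd j) = false.
  by move=> ji; apply: h'out => //; apply: contra ji => /eqP/hd_inj->.
have h_A' x : x \in alive L' -> e h x = false.
  move=> xA; apply/negP=> hx; have := e_hc i x (A' _ xA) hx.
  move: xA; rewrite in_cells in_cell => /andP[_ lx] /and3P[_ /eqP rx /eqP cx].
  by move: lx; rewrite rx cx L'i /C'; move: LC0; rewrite /r0; arith.
have h'_A' x : x \in alive L' -> e h' x = false.
  move=> xA; apply: h'out; first by apply/liveP; right; apply: A'1.
    by apply: contraL xA => /D'.
  by rewrite hdA // A'.
have A'h' x : x \in alive L' -> (x == h') = false.
  by move=> xA; apply: contraTF xA => /eqP->; apply: D'.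
exists L', hd', (join h' N (lc e h)); split.
  apply: reduces_trans red1 _; apply: (reduces_weaken red2) => //.
  apply/subsetP=> x /liveP[[j ->]|xA]; rewrite in_setU1 in_setD in_setU1 negb_or.
    rewrite /hd'; case: ifP => [_|ji]; first by rewrite eqxx.
    by rewrite hdD hdS1 (inj_eq hd_inj) ji orbT.
  rewrite hdA ?A' //=; apply/orP; right; apply/andP; split; last by apply/liveP; right; apply: A'1.
  by apply: contraL xA => /D'.
split.
- by apply: join_sym; apply: lc_sym.
- by apply: join_irr; apply: lc_irr.
- by move=> r; rewrite /L'; case: ifP => // _; apply: leq_trans (LC r) (leq_addr _ _).
- move=> j k; rewrite /hd'; case: ifP => [/eqP->|ji]; case: ifP => [/eqP->|ki] //.
  + by move/eqP; rewrite h'hd.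
  + by move/eqP; rewrite hdh'.
  exact: hd_inj.
- move=> j; rewrite /hd'; case: ifP => _; first exact: D'.
  by apply: contra (hd_out j); apply: A'.
(* After the complementation [h'] sees exactly those other heads that [h] saw, and the pairs among
   these are toggled, as in [lc H i]. *)
- have iH j : e h (hd j) = H i j by apply: e_hh.
  have Hii : H i i = false by rewrite -e_hh irr_e.
  move=> j k; rewrite /hd' /join /lc.
  have [->|ji] := eqVneq j i; have [->|ki] := eqVneq k i.
  + by rewrite Hii irr_e !eqxx !andbF addbK.
  + by rewrite h'_hd // hh' iH h'hd hdh' N_hd Hii !andbF !addbF /= andbT.
  + by rewrite (sym_e _ h') h'_hd // hh' iH hdh' N_hd Hii !andbF !addbF /= andbT -e_hh sym_e e_hh.
  by rewrite !hdh' !addbF !iH e_hh (inj_eq hd_inj).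
- move=> x y xA yA; rewrite /join /lc (h_A' x xA) (A'h' x xA) (A'h' y yA) /= !addbF; apply: e_cc; exact: A'.
- move=> j x xA; rewrite /hd' /join /lc (h_A' x xA) (A'h' x xA) andbF !addbF.
  have [->|ji] := eqVneq j i.
    by rewrite eqxx /= h'_A' // addFb L'i => /Ncell.
  by rewrite hdh' /= addbF L'j //; apply: e_hc; apply: A'.
move=> j; have [->|ji] := eqVneq j i.
  have y0A := cellA' _ (Ncell _ Ny0).
  exists y0; first by rewrite L'i; apply: Ncell.
  by rewrite /hd' eqxx /join /lc eqxx (h_A' _ y0A) (h'_A' _ y0A) (A'h' _ y0A) Ny0 andbF.
have [x xc ex] := touch j; exists x; first by rewrite L'j.
have xA : x \in alive L' by have [px rx cx] := cellK _ _ _ xc; rewrite in_cells px rx cx L'j /=.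
by rewrite /hd' (negbTE ji) /join /lc (h_A' _ xA) (A'h' _ xA) hdh' ex andbF.
Qed.

(** Wire [i] sends a branch down and wire [j] a branch up in the same column. The period 9 of the
    wires is accounted for by one wire row, three rows for each branch, and two rows for the cells
    [D] holding the inner feet. Finally [hd i] absorbs a path through [D] that leads to [hd j]. *)
Lemma toggle_gate C H L hd e (i j : 'I_n) : wired C H L hd e -> j = i.+1 :> nat -> C + 7 < K ->
  exists L' e', reduces e (live L hd) e' (live L' hd) /\
    wired (C + 7) (toggle i j H) L' hd e'.
Proof.
case=> sym_e irr_e LC hd_inj hd_out e_hh e_cc e_hc touch jE CK.
pose h0 := hd i; pose h1 := hd j; pose C' := C + 7; pose r0 := 9 * i; pose r1 := 9 * j.
have r0E : r0 = 9 * i by [].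
have r1E' : r1 = 9 * j by [].
(* As [L r <= C], column [C + 3] has three columns of room before it, and the strip extends three
   columns beyond it. The wire resumes at the foot in column [C + 7], hence seven columns per
   gate. *)
pose cc := C + 3; pose hi := C + 6.
have r1E : r1 = r0 + 9 by rewrite /r1 /r0 jE; arith.
have r1K : r1 < K by have := ltn_ord j; rewrite /r1; arith.
have r0_9 : 9 %| r0 by rewrite dvdn_mulr.
have r1_9 : 9 %| r1 by rewrite dvdn_mulr.
have h01 : (h0 == h1) = false by rewrite (inj_eq hd_inj) -val_eqE /= jE; arith.
have h10 : (h1 == h0) = false by rewrite eq_sym.
have LC0 := LC r0; have LC1 := LC r1.
(* To the left of column [C'] only the wires are kept, and the stretch of column [cc] between the
   two wires concerned. *)
pose zone r c := (if 9 %| r then L r <= c else C' <= c) || (r0 < r < r1) && (c == cc).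
pose S1 := [set hd i | i in 'I_n] :|: cells zone.
have zone_alive x : x \in cells zone -> x \in alive L.
  rewrite !in_cells => /andP[->] /=; rewrite /zone /cc /C'; have := LC (row x).
  by case: (9 %| row x); arith.
have hd_cell k x : x \in alive L -> (x == hd k) = false.
  by move=> xA; apply: contraNF (hd_out k) => /eqP <-.
have S1P x : x \in S1 -> (exists k, x = hd k) \/ x \in cells zone.
  by case/setUP=> [/imsetP[k _ ->]|]; [left; exists k|right].
have hdS1 k : hd k \in S1 by rewrite in_setU imset_f.
have S1S : S1 \subset live L hd.
  by apply: setUS; apply/subsetP.
have red1 : reduces e (live L hd) e S1 by apply: reduces_sub.
have e_zone x y : x \in cells zone -> y \in cells zone -> e x y ->
    near (row x) (col x) (row y) (col y).
  move=> xz yz; rewrite e_cc ?zone_alive //.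
  by move: xz yz; rewrite !in_cells => /andP[px _] /andP[py _]; apply: (gm_near model).
have hd_zone k x : x \in cells zone -> e (hd k) x -> row x = 9 * k /\ col x = L (9 * k).
  by move=> xz /(e_hc _ _ (zone_alive _ xz)); rewrite in_cell => /and3P[_ /eqP-> /eqP->].
pose inner0 r c := strip r0 (L r0) hi r c || branch true r0 cc 3 r c.
pose outer0 r c := strip r0 (L r0) hi.+1 r c || branch true r0 cc 4 r c.
pose inner1 r c := strip r1 (L r1) hi r c || branch false r1 cc 3 r c.
pose outer1 r c := strip r1 (L r1) hi.+1 r c || branch false r1 cc 4 r c.
(* A weakening of [zone] in which [L] occurs at [r0] and [r1] only, suited to linear arithmetic. *)
have zoneW r c : zone r c -> [&& (r != r0) || (L r0 <= c), (r != r1) || (L r1 <= c) &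
    [|| 9 %| r, C' <= c | (r0 < r < r1) && (c == cc)]].
  rewrite /zone; have [->|_] := eqVneq r r0; first by rewrite r0_9; arith.
  have [->|_] := eqVneq r r1; first by rewrite r1_9; arith.
  by case: (9 %| r); arith.
have in_zone r c : outer0 r c || outer1 r c -> zone r c.
  rewrite /zone /outer0 /outer1 /strip /branch /side /dist /hi /C'.
  have [->|] := eqVneq r r0; first by rewrite r0_9 ltnn; arith.
  have [->|] := eqVneq r r1; first by rewrite r1_9 ltnn; arith.
  by move=> ? ?; case: (9 %| r); arith.
have outer0_zone x : x \in cells outer0 -> x \in cells zone.
  by rewrite !in_cells => /andP[-> o]; apply: in_zone; rewrite o.
have outer1_zone x : x \in cells outer1 -> x \in cells zone.
  by rewrite !in_cells => /andP[-> o]; apply: in_zone; rewrite o orbT.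
have inner_outer0 x : x \in cells inner0 -> x \in cells outer0.
  by rewrite !in_cells => /andP[->] /=; rewrite /inner0 /outer0 /strip /branch /side; arith.
have inner_outer1 x : x \in cells inner1 -> x \in cells outer1.
  by rewrite !in_cells => /andP[->] /=; rewrite /inner1 /outer1 /strip /branch /side; arith.
have cellsP (P : nat -> nat -> bool) x : x \in cells P -> P (row x) (col x).
  by rewrite in_cells => /andP[].
have nbr0 x y : x \in cells inner0 -> y \in S1 -> e x y -> (y == h0) || (y \in cells outer0).
  move=> xi yS exy; have xz := outer0_zone _ (inner_outer0 _ xi).
  have := cellsP _ _ xi; rewrite /inner0 /strip /branch /side /dist /hi /cc.
  case: (S1P y yS) => [[k yk]|yz].
    subst y; rewrite sym_e in exy; have [rx cx] := hd_zone k x xz exy.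
    have [->|ki] := eqVneq k i; first by rewrite eqxx.
    by move: ki; rewrite -val_eqE /= rx /r0; arith.
  have := zoneW _ _ (cellsP _ _ yz); have := e_zone _ _ xz yz exy; rewrite /near.
  have := yz; rewrite !in_cells => /andP[-> _] /=.
  rewrite /outer0 /strip /branch /side /dist /hi /cc /C' => a b c; apply/orP; right; move: a b c; arith.
have nbr1 x y : x \in cells inner1 -> y \in S1 -> e x y -> (y == h1) || (y \in cells outer1).
  move=> xi yS exy; have xz := outer1_zone _ (inner_outer1 _ xi).
  have := cellsP _ _ xi; rewrite /inner1 /strip /branch /side /dist /hi /cc.
  case: (S1P y yS) => [[k yk]|yz].
    subst y; rewrite sym_e in exy; have [rx cx] := hd_zone k x xz exy.
    have [->|kj] := eqVneq k j; first by rewrite eqxx.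
    by move: kj; rewrite -val_eqE /= rx /r1; arith.
  have := zoneW _ _ (cellsP _ _ yz); have := e_zone _ _ xz yz exy; rewrite /near.
  have := yz; rewrite !in_cells => /andP[-> _] /=.
  rewrite /outer1 /strip /branch /side /dist /hi /cc /C' => a b c; apply/orP; right; move: a b c; arith.
have not_hd k x : x \in cells zone -> (x == hd k) = false by move/zone_alive; apply: hd_cell.
have hd_not k (P : nat -> nat -> bool) : (forall x, x \in cells P -> x \in cells zone) -> hd k \notin cells P.
  by move=> PZ; apply/negP=> /PZ/(not_hd k); rewrite eqxx.
have zone_S1 x : x \in cells zone -> x \in S1 by rewrite in_setU orbC => ->.
have [N1 [red2 N1P [u0 u0c Nu0] [u1 u1c Nu1]]] : exists N : pred V,
    [/\ reduces e S1 (join h0 N e) (S1 :\: cells inner0),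
        (forall y, N y -> y \in cells outer0 :\: cells inner0),
        (exists2 y, y \in cell r0 hi.+1 & N y)
      & exists2 y, y \in cells (branch true r0 cc 4) & N y].
  apply: (strip_tripod sym0 model sym_e irr_e) => //.
  - by rewrite /cc; arith.
  - by rewrite /cc /hi; arith.
  - by rewrite /hi; arith.
  - by arith.
  - by apply/subsetP=> x /outer0_zone/zone_S1.
  - by move=> x y /outer0_zone/zone_alive xA /outer0_zone/zone_alive yA; apply: e_cc.
  - exact: hdS1.
  - exact: (hd_not i outer0 outer0_zone).
  - by move=> x /inner_outer0/outer0_zone/zone_alive; apply: e_hc.
  exact: touch.
set e1 := join h0 N1 e in red2; set S2 := S1 :\: _ in red2.
have sym1 : symmetric e1 by apply: join_sym.
have irr1 : irreflexive e1 by apply: join_irr.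
have N1z x : N1 x -> x \in cells zone by move=> /N1P/setDP[/outer0_zone].
have N1arith x : N1 x -> (row x == r0) && (col x == C') || (row x == r0 + 4) && (col x == cc).
  move=> /N1P; rewrite in_setD !in_cells => /andP[nin /andP[px]]; move: nin; rewrite px /=.
  by rewrite /inner0 /outer0 /strip /branch /side /dist /hi /C'; arith.
have N1hd k : N1 (hd k) = false by apply/negP=> /N1z/(not_hd k); rewrite eqxx.
have e1z x y : x \in cells zone -> e1 x y = e x y (+) ((y == h0) && N1 x).
  by move=> xz; rewrite /e1 /join not_hd //= addbF.
have S2S1 x : x \in S2 -> x \in S1 by case/setDP.
have in_S2 x : x \in S1 -> x \notin cells inner0 -> x \in S2 by move=> xS xi; rewrite in_setD xi.
have hdS2 k : hd k \in S2.
  by apply: in_S2 => //; apply: hd_not => x /inner_outer0/outer0_zone.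
have rows1 x : x \in cells outer1 -> r0 + 5 <= row x <= r1.
  by move/cellsP; rewrite /outer1 /strip /branch /side /dist; arith.
have rows1' x : x \in cells inner1 -> r0 + 6 <= row x <= r1.
  by move/cellsP; rewrite /inner1 /strip /branch /side /dist; arith.
have rows0 x : x \in cells inner0 -> r0 <= row x <= r0 + 3.
  by move/cellsP; rewrite /inner0 /strip /branch /side /dist; arith.
(* The first absorption touched, besides the head, only rows [r0] and [r0 + 4], while the second
   tripod starts at row [r0 + 6]. *)
have e1inner x y : x \in cells inner1 -> e1 x y = e x y.
  move=> xi; rewrite e1z ?(outer1_zone _ (inner_outer1 _ xi)) //.
  case N1x : (N1 x); rewrite ?andbF ?addbF //.
  by have := N1arith _ N1x; have := rows1' _ xi; arith.
have [N2 [red3 N2P [v0 v0c Nv0] [v1 v1c Nv1]]] : exists N : pred V,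
    [/\ reduces e1 S2 (join h1 N e1) (S2 :\: cells inner1),
        (forall y, N y -> y \in cells outer1 :\: cells inner1),
        (exists2 y, y \in cell r1 hi.+1 & N y)
      & exists2 y, y \in cells (branch false r1 cc 4) & N y].
  apply: (strip_tripod sym0 model sym1 irr1) => //.
  - by rewrite /cc; arith.
  - by rewrite /cc /hi; arith.
  - by rewrite /hi; arith.
  - by rewrite r1K andbT; arith.
  - apply/subsetP=> x xo; apply: in_S2; first exact/zone_S1/outer1_zone.
    by apply/negP=> /rows0; have := rows1 _ xo; arith.
  - move=> x y /outer1_zone xz /outer1_zone yz; rewrite e1z // (not_hd _ y) //= addbF.
    by apply: e_cc; apply: zone_alive.
  - exact: hdS2.
  - exact: (hd_not j outer1 outer1_zone).
  - by move=> x y xi /S2S1 yS; rewrite e1inner //; apply: nbr1.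
  - move=> x xi; rewrite sym1 e1inner // sym_e => /hd_zone -/(_ (outer1_zone _ (inner_outer1 _ xi)))[rx cx].
    by move: (inner_outer1 _ xi); rewrite in_cells in_cell => /andP[-> _]; rewrite rx cx !eqxx.
  have [v vc ev] := touch j; exists v => //.
  by rewrite /e1 /join h10 /= addbF ev; case: eqP => // E; move: vc;
    rewrite E in_cell => /andP[ph _]; rewrite andbC N1hd.
set e2 := join h1 N2 e1 in red3; set S3 := S2 :\: _ in red3.
have sym2 : symmetric e2 by apply: join_sym.
have irr2 : irreflexive e2 by apply: join_irr.
have N2z x : N2 x -> x \in cells zone by move=> /N2P/setDP[/outer1_zone].
have N2arith x : N2 x -> (row x == r1) && (col x == C') || (row x == r0 + 5) && (col x == cc).
  move=> /N2P; rewrite in_setD !in_cells => /andP[nin /andP[px]]; move: nin; rewrite px /=.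
  by rewrite /inner1 /outer1 /strip /branch /side /dist /hi /C'; arith.
have N2hd k : N2 (hd k) = false by apply/negP=> /N2z/(not_hd k); rewrite eqxx.
have e2z x y : x \in cells zone -> e2 x y = e x y (+) ((y == h0) && N1 x) (+) ((y == h1) && N2 x).
  by move=> xz; rewrite /e2 /join not_hd //= addbF e1z.
have e2hd k x : x \in cells zone ->
    e2 (hd k) x = e (hd k) x (+) ((k == i) && N1 x) (+) ((k == j) && N2 x).
  by move=> xz; rewrite sym2 e2z // sym_e !(inj_eq hd_inj).
pose D := cells (fun r c => [&& r0 + 4 <= r, r <= r0 + 5 & c == cc]).
have DP x : x \in D -> [/\ placed x, r0 + 4 <= row x <= r0 + 5 & col x = cc].
  by rewrite in_cells => /and4P[-> -> -> /eqP->].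
have Dz x : x \in D -> x \in cells zone.
  case/DP=> px rx cx; rewrite in_cells px /= /zone cx; case: (9 %| row x); arith.
have in_S3 x : x \in S2 -> x \notin cells inner1 -> x \in S3 by move=> xS xi; rewrite in_setD xi.
have S3S2 x : x \in S3 -> x \in S2 by case/setDP.
have hdS3 k : hd k \in S3.
  by apply: in_S3 => //; apply: hd_not => x /inner_outer1/outer1_zone.
have DS3 : D \subset S3.
  apply/subsetP=> x xD; have [_ rx _] := DP _ xD; apply: in_S3; last by apply/negP=> /rows1'; arith.
  by apply: in_S2; [apply/zone_S1/Dz|apply/negP=> /rows0; arith].
have hdD k : hd k \notin D by apply: hd_not.
have eD_hd k x : x \in D -> e (hd k) x = false.
  move=> xD; apply/negP=> /(hd_zone _ _ (Dz _ xD))[rx _].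
  by have [_ rx' _] := DP _ xD; move: rx rx'; arith.
have Dnbr x y : x \in D -> y \in S3 -> e x y -> y \in D.
  move=> xD yS exy; have [px rx cx] := DP _ xD.
  case: (S1P y (S2S1 _ (S3S2 _ yS))) => [[k yk]|yz].
    by subst y; rewrite sym_e eD_hd in exy.
  have := yS; rewrite in_setD => /andP[yi1]; rewrite in_setD => /andP[yi0 _].
  have := e_zone _ _ (Dz _ xD) yz exy; have := zoneW _ _ (cellsP _ _ yz).
  move: yi1 yi0 yz; rewrite !in_cells => yi1 yi0 /andP[py _]; move: yi1 yi0; rewrite py cx /=.
  rewrite /near /inner0 /inner1 /strip /branch /side /dist /hi /cc /C'.
  by move: rx; arith.
(* In [D] the head [h0] sees only row [r0 + 4] and [h1] only row [r0 + 5]. With a single cell, one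
   vertex could see both heads and the path would be too short to be absorbed. *)
have Dfar x y : x \in D -> e2 h0 x -> y \in S3 -> y != h0 -> e2 x y -> y \in D.
  move=> xD; rewrite e2hd ?Dz // eD_hd // eqxx [i == j](_ : _ = false) /=; last first.
    by rewrite -val_eqE /= jE; arith.
  rewrite addbF => N1x yS yh; rewrite e2z ?Dz // (negbTE yh) addbF => exy.
  have [yh1|yh1] := eqVneq y h1; last by apply: (Dnbr x); move: exy; rewrite ?(negbTE yh1) ?addbF.
  move: exy; rewrite yh1 eqxx sym_e eD_hd //= => N2x.
  by have := N1arith _ N1x; have := N2arith _ N2x; have [_ _ cx] := DP _ xD; rewrite cx /cc /C'; arith.
have u1D : u1 \in D.
  by have := N1arith _ Nu1; move: u1c; rewrite !in_cells /branch /side /dist => /andP[->] /=; rewrite /C' /cc; arith.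
have v1D : v1 \in D.
  by have := N2arith _ Nv1; move: v1c; rewrite !in_cells /branch /side /dist => /andP[->] /=; rewrite /C' /cc; arith.
have ru1 : row u1 = r0 + 4.
  by have := N1arith _ Nu1; have [_ _ ->] := DP _ u1D; rewrite /C' /cc; arith.
have rv1 : row v1 = r0 + 5.
  by have := N2arith _ Nv1; have [_ _ ->] := DP _ v1D; rewrite /C' /cc; arith.
have e_D : {in D &, e2 =2 e0}.
  move=> x y xD yD; rewrite e2z ?Dz // !(not_hd _ y) ?Dz //= !addbF.
  by apply: e_cc; apply/zone_alive/Dz.
have link : linked e2 D (e2 h0) (fun x => [exists y in S3 :\: (h0 |: D), e2 x y]).
  exists u1, v1; split=> //.
  - by rewrite e2hd ?Dz // eD_hd // eqxx Nu1 /= -val_eqE /= jE; case: eqP => //; arith.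
  - apply/exists_inP; exists h1; last first.
      by rewrite sym2 e2hd ?Dz // eD_hd // eqxx Nv1 -val_eqE /= jE; case: eqP => //; arith.
    by rewrite in_setD in_setU1 negb_or h10 hdD hdS3.
  rewrite (within_eq e_D).
  have ccK : cc < K by rewrite /cc; arith.
  apply: (@chain_connect _ e0 D (fun k => cell (r0 + 4 + k) cc) 1).
  - by move=> k km; apply: cell_cells; rewrite eqxx; arith.
  - by move=> k x y km; apply: (gm_conn model) => //; arith.
  - by move=> k km; apply: (cell_edge sym0 model) => //; arith.
  - by have [pu _ cu] := DP _ u1D; rewrite in_cell pu cu ru1 addn0 !eqxx.
  by have [pu _ cu] := DP _ v1D; rewrite in_cell pu cu rv1 -addnA !eqxx.
have [N3 [red4 N3P [w Nw]]] := absorb_path sym2 irr2 (hdS3 i) DS3 (hdD i) Dfar link.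
(* Apart from [h0], only [h1] remains as a neighbour of [D] outside [D]. Since [N3] is nonempty, the
   absorption toggles exactly the pair of [h0] and [h1]. *)
have N3h1 y : N3 y -> y = h1.
  case/N3P=> yS yD yh [x xD]; rewrite e2z ?Dz // (negbTE yh) addbF.
  have [//|yh1] := eqVneq y h1; rewrite addbF => /(Dnbr _ _ xD yS).
  by rewrite (negbTE yD).
have N3E y : N3 y = (y == h1).
  apply/idP/eqP => [/N3h1 //|->]; by rewrite -(N3h1 _ Nw).
pose L' r := if [&& 9 %| r, r != r0 & r != r1] then L r else C'.
have LL' r : L r <= L' r.
  by rewrite /L'; case: ifP => // _; apply: leq_trans (LC r) _; rewrite /C'; arith.
have A' x : x \in alive L' -> x \in alive L by apply: (subsetP (alive_sub LL')).
have A'W x : x \in alive L' -> [|| [&& 9 %| row x, row x != r0 & row x != r1] | C' <= col x].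
  by rewrite in_cells /L' => /andP[_]; case: ifP => //= _ ->.
have A'z x : x \in alive L' -> x \in cells zone.
  rewrite !in_cells => /andP[->] /=; rewrite /L' /zone; case: (9 %| row x) => /=; last by move->.
  by case: ifP => _; [move->|move=> h; have := LC (row x); rewrite /C' in h; arith].
have L'0 : L' (9 * i) = C' by rewrite /L' eqxx andbF.
have L'1 : L' (9 * j) = C' by rewrite /L' eqxx !andbF.
have L'k (k : 'I_n) : k != i -> k != j -> L' (9 * k) = L (9 * k).
  move=> ki kj; rewrite /L' dvdn_mulr //= ifT //.
  by move: ki kj; rewrite -!val_eqE /= /r0 /r1; arith.
have N1A' x : x \in alive L' -> N1 x -> x \in cell r0 C'.
  move=> xA N1x; have := A'W _ xA; have := N1arith _ N1x.
  have := N1z _ N1x; rewrite in_cells in_cell => /andP[-> _] /=; rewrite /cc /C'; arith.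
have N2A' x : x \in alive L' -> N2 x -> x \in cell r1 C'.
  move=> xA N2x; have := A'W _ xA; have := N2arith _ N2x.
  have := N2z _ N2x; rewrite in_cells in_cell => /andP[-> _] /=; rewrite /cc /C'; arith.
have hd_A' x (k : 'I_n) : x \in alive L' -> e (hd k) x -> (k != i) && (k != j).
  move=> xA /(hd_zone _ _ (A'z _ xA))[rx cx].
  have := A'W _ xA; rewrite rx cx -!val_eqE /=; have := LC (9 * k); rewrite /C' /r0 /r1; arith.
exists L', (join h0 N3 e2); split.
  apply: reduces_trans red1 _; apply: reduces_trans red2 _; apply: reduces_trans red3 _.
  apply: (reduces_weaken red4) => //; apply/subsetP=> x /liveP[[k ->]|xA].
    by rewrite in_setD hdD hdS3.
  have xw := A'W _ xA; rewrite in_setD in_S3 ?andbT; first last.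
  - by apply/negP=> /cellsP; move: xw; rewrite /inner1 /strip /branch /side /dist /hi /cc /C'; arith.
  - apply: in_S2; first by apply/zone_S1/A'z.
    by apply/negP=> /cellsP; move: xw; rewrite /inner0 /strip /branch /side /dist /hi /cc /C'; arith.
  by apply/negP=> /DP[_]; move: xw; rewrite /cc /C'; arith.
have e3z x y : x \in cells zone -> join h0 N3 e2 x y = e2 x y.
  by move=> xz; rewrite /join !N3E !(not_hd _ x) //= andbF !addbF.
split=> //.
- exact: join_sym.
- exact: join_irr.
- by move=> r; rewrite /L'; case: ifP => // _; apply: leq_trans (LC r) (leq_addr _ _).
- by move=> k; apply: contra (hd_out k); apply: A'.
- move=> a b; rewrite /join !N3E /e2 /join !N2hd /e1 /join !N1hd !andbF !addbF e_hh.
  by rewrite !(inj_eq hd_inj).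
- move=> x y xA yA; rewrite e3z ?A'z // e2z ?A'z // !(not_hd _ y) ?A'z //= !addbF.
  by apply: e_cc; apply: A'.
- move=> k x xA; rewrite (join_sym _ _ sym2) e3z ?A'z // sym2 e2hd ?A'z //.
  case ekx : (e (hd k) x).
    have /andP[ki kj] := hd_A' _ _ xA ekx; rewrite (negbTE ki) (negbTE kj) /= => _.
    by rewrite L'k //; apply: e_hc ekx; apply: A'.
  have [->|ki] := eqVneq k i; have [kj|kj] := eqVneq _ j.
  + by move: jE; rewrite -kj; arith.
  + by rewrite L'0 /= addbF; apply: N1A'.
  + by rewrite kj L'1 /=; apply: N2A'.
  by rewrite /= .
have hiC : hi.+1 = C' by rewrite /hi /C'; arith.
have inA' r x : x \in cell r (L' r) -> x \in alive L'.
  by rewrite in_cell in_cells => /and3P[-> /eqP-> /eqP->] /=.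
have ij : (i == j) = false by rewrite -val_eqE /= jE; arith.
have ji : (j == i) = false by rewrite eq_sym.
move=> k; have [->|ki] := eqVneq k i.
  have u0A : u0 \in alive L' by apply: (inA' r0); rewrite L'0 -hiC.
  exists u0; first by rewrite L'0 -hiC.
  rewrite (join_sym _ _ sym2) e3z ?A'z // sym2 e2hd ?A'z // eqxx ij Nu0.
  by case E : (e (hd i) u0) => //; have := hd_A' _ _ u0A E; rewrite eqxx.
have [->|kj] := eqVneq k j.
  have v0A : v0 \in alive L' by apply: (inA' r1); rewrite L'1 -hiC.
  exists v0; first by rewrite L'1 -hiC.
  rewrite (join_sym _ _ sym2) e3z ?A'z // sym2 e2hd ?A'z // eqxx ji Nv0.
  by case E : (e (hd j) v0) => //; have := hd_A' _ _ v0A E; rewrite eqxx andbF.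
have [x xc ex] := touch k; have xA : x \in alive L' by apply: (inA' (9 * k)); rewrite L'k.
exists x; first by rewrite L'k.
by rewrite (join_sym _ _ sym2) e3z ?A'z // sym2 e2hd ?A'z // (negbTE ki) (negbTE kj) ex.
Qed.

End Wires.

(** The initial heads are chosen in column 0 so as to have a neighbour in column 1, where the wires
    start. They are pairwise nonadjacent because their rows differ by at least 9. *)
Lemma circuit_wired (V : finType) (e0 : rel V) (placed : pred V) (row col : V -> nat) K n m
    (H : rel 'I_n) : symmetric e0 -> irreflexive e0 -> grid_model e0 placed row col K ->
  9 * n <= K -> circuit m H -> 7 * m + 1 < K ->
  exists L hd e, reduces e0 [set: V] e (live placed row col L hd) /\
    wired e0 placed row col (7 * m + 1) H L hd e.
Proof.
move=> sym0 irr0 model nK; elim=> {m H} [H H0|m H i j H' _ IH ij HE|m H k H' _ IH HE] mK.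
- have start (i : 'I_n) : exists x, [/\ placed x, row x = 9 * i, col x = 0 &
      exists2 y, y \in grid_cell placed row col (9 * i) 1 & e0 x y].
    have [] := gm_right model (r := 9 * i) (c := 0); [have := ltn_ord i; lia|lia|].
    move=> x [y [xc yc exy]]; exists x; move: xc; rewrite in_cell => /and3P[-> /eqP-> /eqP->].
    by split=> //; exists y.
  have [hd hdP] := choice start.
  exists (fun=> 1), hd, e0; split; first exact: reduces_sub.
  split=> //.
  - move=> i j eq_ij; have [_ ri _ _] := hdP i; have [_ rj _ _] := hdP j.
    by apply: val_inj; rewrite /=; move: ri rj; rewrite eq_ij; lia.
  - by move=> i; have [_ _ ci _] := hdP i; rewrite in_cells ci andbF.
  - move=> i j; rewrite H0; have [-> //|ne] := eqVneq i j.
    apply/negP; have [pi ri _ _] := hdP i; have [pj rj _ _] := hdP j.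
    move/(gm_near model pi pj); rewrite ri rj /near.
    by move: ne; rewrite -val_eqE /=; lia.
  - move=> i x; rewrite in_cells in_cell => /andP[px cx]; have [pi ri ci _] := hdP i.
    move/(gm_near model pi px); rewrite px ri ci /near /=.
    by move: cx; lia.
  by move=> i; have [_ _ _ []] := hdP i => y; exists y.
- have [L [hd [e [red w]]]] := IH ltac:(lia).
  have [L' [e' [red' w']]] := toggle_gate sym0 model nK w ij ltac:(lia).
  exists L', hd, e'; split; first exact: reduces_trans red red'.
  have -> : 7 * m.+1 + 1 = 7 * m + 1 + 7 by lia.
  by case: w' => *; split=> // a b; rewrite HE.
have [L [hd [e [red w]]]] := IH ltac:(lia).
have [L' [hd' [e' [red' w']]]] := lc_gate sym0 model nK k w ltac:(lia).
exists L', hd', e'; split; first exact: reduces_trans red red'.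
have -> : 7 * m.+1 + 1 = 7 * m + 1 + 7 by lia.
by case: w' => *; split=> // a b; rewrite HE.
Qed.

(** * Induced minors and vertex-minors *)

(** Branch sets are the fibres of [bag], hence disjoint by construction, and [None] marks deleted
    vertices. The equivalence in [mm_adj] is what makes the minor induced. *)
Record minor_model (G M : graph) (bag : G -> option M) : Prop := MinorModel {
  mm_onto : forall u, exists x, bag x = Some u;
  mm_conn : forall u x y, bag x = Some u -> bag y = Some u ->
    connect (within [set z | bag z == Some u] (@adj G)) x y;
  mm_adj : forall u v, u != v ->
    adj u v <-> exists x y, [/\ bag x = Some u, bag y = Some v & adj x y] }.

Lemma minor_model_start (G : graph) : minor_model (fun x : G => Some x).
Proof.
split=> [u|u x y [->] [->]|u v _]; [by exists u|exact: connect0|].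
by split=> [uv|[x [y [[->] [->]]]] //]; exists u, v.
Qed.

Lemma minor_model_delete (G M : graph) (bag : G -> option M) (v : M) : minor_model bag ->
  minor_model (fun x => obind insub (bag x) : option (delete_vertex v)).
Proof.
move=> mm; set bag' := fun x => _.
have bagE x (u : delete_vertex v) : bag' x = Some u <-> bag x = Some (val u).
  rewrite /bag'; case: (bag x) => [w|] //=; split=> [|[->]]; last by rewrite valK.
  by case: insubP => // s _ <- [->].
split=> [u|u x y /bagE xu /bagE yu|u w uw].
- by have [x xu] := mm_onto mm (val u); exists x; apply/bagE.
- apply: connect_within_sub (mm_conn mm xu yu); apply/subsetP=> z; rewrite !inE => /eqP zu.
  by apply/eqP/bagE.
have uw' : val u != val w by rewrite (inj_eq val_inj).
rewrite (mm_adj mm uw'); split=> -[x [y [xu yw exy]]]; exists x, y; split=> //; exact/bagE.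
Qed.

(** The bag of [v] is merged into that of [u]; the edge [uv] provides an edge between the two bags,
    which keeps the union connected. *)
Lemma minor_model_contract (G M : graph) (bag : G -> option M) (u v : M) : adj u v ->
  minor_model bag ->
  minor_model (fun x => obind (fun w => insub (if w == v then u else w)) (bag x)
    : option (contract u v)).
Proof.
move=> uv mm; set bag' := fun x => _.
have u_ne_v : u != v by apply: contraTneq uv => ->; rewrite adj_irr.
have bagE x (w : contract u v) :
    bag' x = Some w <-> bag x = Some (val w) \/ val w = u /\ bag x = Some v.
  rewrite /bag'; case: (bag x) => [z|] /=; last by split=> // -[|[]].
  split=> [|[[->]|[wu [->]]]]; last 2 first.
  - by rewrite (negbTE (valP w)) valK.
  - by rewrite eqxx -wu valK.
  case: insubP => // s _ sE [<-]; rewrite sE; case: eqP => [->|_]; by [right|left].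
have bag_val x (w : contract u v) : bag x = Some (val w) -> bag' x = Some w.
  by move=> xw; apply/bagE; left.
have bag_u x (w : contract u v) : val w = u -> bag x = Some v -> bag' x = Some w.
  by move=> wu xv; apply/bagE; right.
have sub w : [set z | bag z == Some (val w)] \subset [set z | bag' z == Some w].
  by apply/subsetP=> z; rewrite !inE => /eqP/bag_val/eqP.
have subv w : val w = u -> [set z | bag z == Some v] \subset [set z | bag' z == Some w].
  by move=> wu; apply/subsetP=> z; rewrite !inE => /eqP/(bag_u _ _ wu)/eqP.
split.
- by move=> w; have [x xw] := mm_onto mm (val w); exists x; apply: bag_val.
- have [a [b [au bv eab]]] := (mm_adj mm u_ne_v).1 uv.
  have uv_conn w x y : val w = u -> bag x = Some u -> bag y = Some v ->
      connect (within [set z | bag' z == Some w] (@adj G)) x y.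
    move=> wu xu yv; apply: (@connect_trans _ _ a).
      by apply: connect_within_sub (sub w) _; rewrite wu; apply: (mm_conn mm).
    apply: (@connect_trans _ _ b).
      apply: connect1; apply/and3P; rewrite !inE; split=> //; apply/eqP; first by apply: bag_val; rewrite wu.
      exact: bag_u.
    by apply: connect_within_sub (subv w wu) _; apply: (mm_conn mm).
  have wsym w : connect_sym (within [set z | bag' z == Some w] (@adj G)).
    by apply: sym_connect_sym => x y; apply/and3P/and3P=> -[? ?]; rewrite adj_sym.
  move=> w x y /bagE[xw|[wu xv]] /bagE[yw|[wu' yv]].
  + by apply: connect_within_sub (sub w) _; apply: (mm_conn mm).
  + by apply: uv_conn; rewrite -?wu'.
  + by rewrite wsym; apply: uv_conn; rewrite -?wu.
  by apply: connect_within_sub (subv w wu) _; apply: (mm_conn mm).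
move=> w z wz; have wz' : val w != val z by rewrite (inj_eq val_inj).
rewrite {1}/adj /= /contract_rel wz /=.
have vz : v != val z by rewrite eq_sym (valP z).
have vw : v != val w by rewrite eq_sym (valP w).
split=> [/or3P[]|[x [y [/bagE xw /bagE yz exy]]]].
- by move/(mm_adj mm wz')=> [x [y [xw yz exy]]]; exists x, y; split=> //; apply: bag_val.
- case/andP=> /eqP wu /(mm_adj mm vz)[x [y [xv yz exy]]].
  by exists x, y; split; [apply: bag_u|apply: bag_val|].
- case/andP=> /eqP zu /(mm_adj mm vw)[y [x [yv xw exy]]].
  by exists x, y; split; [apply: bag_val|apply: bag_u|rewrite adj_sym].
case: xw yz => [xw|[wu xv]] [yz|[zu yv]].
- by apply/orP; left; apply/(mm_adj mm wz'); exists x, y.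
- apply/or3P/Or33; rewrite zu eqxx /=; apply/(mm_adj mm vw); exists y, x.
  by rewrite adj_sym.
- by apply/or3P/Or32; rewrite wu eqxx /=; apply/(mm_adj mm vz); exists x, y.
by rewrite wu zu eqxx in wz'.
Qed.

Lemma im_obtained_model G M : im_obtained G M -> exists bag : G -> option M, minor_model bag.
Proof.
elim=> [|{}M v _ [bag mm]|{}M u v uv _ [bag mm]].
- by exists (fun x => Some x); apply: minor_model_start.
- by eexists; apply: minor_model_delete mm.
by eexists; apply: minor_model_contract mm.
Qed.

Lemma grid_minor_model G k : induced_minor (grid k) G ->
  exists placed row col, grid_model (@adj G) placed row col k.
Proof.
case=> M /im_obtained_model[bag mm] [f [g fK gK] f_adj].
pose placed x := bag x != None.
(* The default 0 is harmless, since conditions on rows and columns are always guarded by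
   [placed]. *)
pose row x := if bag x is Some u then nat_of_ord (g u).1 else 0.
pose col x := if bag x is Some u then nat_of_ord (g u).2 else 0.
exists placed, row, col.
pose cel := grid_cell placed row col.
have celP r c x : reflect (exists u, [/\ bag x = Some u, (g u).1 = r :> nat & (g u).2 = c :> nat]) (x \in cel r c).
  rewrite in_cell /placed /row /col; case: (bag x) => [u|] /=; last by apply: ReflectF => -[u []].
  apply: (iffP andP) => [[/eqP ru /eqP cu]|[w [[<-] -> ->]]]; last by rewrite !eqxx.
  by exists u.
have cell_f (p : grid k) x : bag x = Some (f p) -> x \in cel p.1 p.2.
  by move=> xp; apply/celP; exists (f p); rewrite fK.
have grid_edge (p q : grid k) : adj p q ->
    exists x y, [/\ x \in cel p.1 p.2, y \in cel q.1 q.2 & adj x y].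
  move=> pq; have fpq : f p != f q.
    by rewrite (can_eq fK); apply: contraTneq pq => ->; rewrite adj_irr.
  have /(mm_adj mm fpq)[x [y [xp yq exy]]] : adj (f p) (f q) by rewrite f_adj.
  by exists x, y; split=> //; apply: cell_f.
split.
- move=> x y; rewrite /placed /row /col; case xu : (bag x) => [u|] // _; case yv : (bag y) => [v|] // _ exy.
  have [->|uv] := eqVneq u v; first by rewrite /near; lia.
  have : adj u v by apply/(mm_adj mm uv); exists x, y.
  rewrite -(gK u) -(gK v) f_adj !fK /= /grid_rel /differ_by_one /near -!val_eqE /=; lia.
- move=> r c x y _ _ /celP[u [xu ru cu]] /celP[v [yv rv cv]].
  have uv : u = v.
    apply: (can_inj gK); move: ru cu rv cv; case: (g u) (g v) => [a b] [a' b'] /= <- <- ra cb.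
    by congr pair; apply: val_inj.
  subst v; apply: connect_within_sub (mm_conn mm xu yv).
  by apply/subsetP=> z; rewrite inE => /eqP zu; apply/celP; exists u.
- move=> r c rk ck; have ck' := ltnW ck.
  have := grid_edge (Ordinal rk, Ordinal ck') (Ordinal rk, Ordinal ck); apply.
  by rewrite /adj /= /grid_rel /differ_by_one /= !eqxx orbT.
move=> r c rk ck; have rk' := ltnW rk.
have := grid_edge (Ordinal rk', Ordinal ck) (Ordinal rk, Ordinal ck); apply.
by rewrite /adj /= /grid_rel /differ_by_one /= !eqxx !orbT.
Qed.

(** The vertices missed by [f] are deleted one at a time. *)
Lemma induced_vertex_minor (G M H : graph) (f : H -> M) : vm_obtained G M ->
  injective f -> (forall x y, adj (f x) (f y) = adj x y) -> vertex_minor H G.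
Proof.
move: {2}#|M| (leqnn #|M|) => b.
elim: b M f => [|b IH] M f leb GM f_inj f_adj.
  have M0 : #|M| = 0 by apply/eqP; rewrite -leqn0.
  have noM (x : M) : False by have := card0_eq M0 x; rewrite inE.
  exists M => //; exists f => //.
  by exists (fun x => False_rect H (noM x)) => x; [case: (noM (f x))|case: (noM x)].
have [onto|] := boolP [forall y : M, y \in codom f].
  exists M => //; exists f => //; apply: inj_card_bij => //.
  rewrite -(card_codom f_inj); apply/subset_leq_card/subsetP=> y _.
  exact: (forallP onto).
rewrite negb_forall => /existsP[v vf].
have fv x : f x != v by apply: contraNneq vf => <-; apply: codom_f.
pose f' x : delete_vertex v := exist (fun y => y != v) (f x) (fv x).
apply: (IH (delete_vertex v) f') => //.
- rewrite /= card_sig -ltnS; apply: leq_trans leb.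
  by rewrite (cardD1 v M) inE ltnS subset_leq_card //; apply/subsetP=> x; rewrite !inE andbT.
- exact: vm_delete.
by move=> x y [/f_inj].
Qed.

Lemma vm_obtained_lcs (G : graph) (V : finType) (e : rel V) (sym_e : symmetric e)
    (irr_e : irreflexive e) s : vm_obtained G (Graph sym_e irr_e) ->
  exists (sym' : symmetric (lcs e s)) (irr' : irreflexive (lcs e s)),
    vm_obtained G (Graph sym' irr').
Proof.
elim: s e sym_e irr_e => [|v s IH] e sym_e irr_e Ge; first by exists sym_e, irr_e.
(* The relation of [local_compl] is convertible to [lc e v], and the proofs carried by that graph
   serve as the new symmetry and irreflexivity proofs. *)
exact: IH (vm_local_compl (v : Graph sym_e irr_e) Ge).
Qed.

Lemma reduces_vertex_minor (G H : graph) e S (f : H -> G) :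
  reduces (@adj G) [set: G] e S -> injective f -> (forall x, f x \in S) ->
  (forall x y, e (f x) (f y) = adj x y) -> vertex_minor H G.
Proof.
case=> _ [s _ sE] f_inj fS f_adj.
(* Destructing [G] makes it convertible to the graph rebuilt from its own fields. *)
have GG : vm_obtained G (Graph (@adj_sym G) (@adj_irr G)) by case: G {e S f s sE f_inj fS f_adj} => *; constructor.
have [sym' [irr' Gs]] := vm_obtained_lcs s GG.
by apply: (induced_vertex_minor Gs f_inj) => x y; rewrite /= sE.
Qed.

Theorem theorem22 (C : graph -> Prop) :
  proper_class C -> vertex_minor_closed C ->
  exists k : nat, forall G : graph, C G -> igrid G <= k.
Proof.
move=> properC closedC.
have [H nCH] : exists H, ~ C H by apply/existsNP.
pose h : rel 'I_#|H| := fun a b => adj (enum_val a) (enum_val b).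
have [m circ] : exists m, circuit m h.
  by apply: circuit_all => [a b|a]; [apply: adj_sym|apply: adj_irr].
(* The run needs [9 * #|H|] rows for the wires and [7 * m + 2] columns: column 0 for the heads,
   seven columns per gate, and one where the wires still continue. The sum bounds both. *)
exists (9 * #|H| + 7 * m + 2) => G CG; rewrite leqNgt; apply/negP=> big.
have [placed [row [col model]]] := grid_minor_model (igridP G).1.
have rows_le : 9 * #|H| <= igrid G by apply: leq_trans (ltnW big); rewrite -addnA leq_addr.
have cols_lt : 7 * m + 1 < igrid G.
  by apply: leq_ltn_trans big; rewrite -addnA; apply: leq_trans (leq_addl _ _); rewrite leq_add2l.
have [L [hd [e [red w]]]] := circuit_wired (@adj_sym G) (@adj_irr G) model rows_le circ cols_lt.
apply: nCH; apply: (closedC G) => //.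
apply: (reduces_vertex_minor red (f := hd \o enum_rank)).
- by apply: inj_comp; [apply: wd_inj w|apply: enum_rank_inj].
- by move=> x; apply/liveP; left; exists (enum_rank x).
by move=> x y; rewrite /= (wd_hh w) /h !enum_rankK.
Qed.
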